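(* For any artin algebra $\Lambda$, we have (1) $\mathrm{tri.dim}\, D^b(\Lambda\text{-}\mathrm{mod})\leqslant 2\,\mathrm{lrep.dis}(\Lambda)+1$; (2) $\mathrm{ext.dim}\,\Lambda\leqslant\mathrm{lrep.dis}(\Lambda)+1$.
   Context: For an artin algebra $\Lambda$, $\Lambda\text{-}\mathrm{mod}$ denotes the category of finitely generated left $\Lambda$-modules, $D^b(\Lambda\text{-}\mathrm{mod})$ its bounded derived category, and $\mathrm{rad}(\Lambda)$ the Jacobson radical. For a class $\mathcal U$ of objects, $\mathrm{add}\,\mathcal U$ is the full subcategory of direct summands of finite direct sums of objects in $\mathcal U$. Left representation distance $\mathrm{lrep.dis}(\Lambda)$: it is $0$ if $\Lambda$ is representation-finite; if $\Lambda$ is not representation-finite, it is the minimum of all $s$ such that there exists a chain of subalgebras $\Lambda=\Lambda_0\subsetneq\Lambda_1\subsetneq\Lambda_2\subsetneq\cdots\subsetneq\Lambda_s$ (artin algebras, with the same identity) such that $\mathrm{rad}(\Lambda_i)$ is a left ideal in $\Lambda_{i+1}$ for all $i$ and $\Lambda_s$ is representation-finite (the minimum of the empty set being read as $\infty$). Dimension of a triangulated category $\mathcal T$: for $\mathcal I\subseteq\mathrm{Ob}\,\mathcal T$ let $\langle\mathcal I\rangle_1=\mathrm{add}\{X[i]\mid X\in\mathcal I, i\in\mathbb Z\}$. For $\mathcal I_1,\mathcal I_2\subseteq\mathrm{Ob}\,\mathcal T$ let $\mathcal I_1*\mathcal I_2$ be the full subcategory of objects $X$ fitting in a distinguished triangle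 $X_1\to X\to X_2\to X_1[1]$ with $X_1\in\mathcal I_1$, $X_2\in\mathcal I_2$, and let $\mathcal I_1\diamond\mathcal I_2=\langle\mathcal I_1*\mathcal I_2\rangle_1$. Put $\langle\mathcal I\rangle_0=0$ and $\langle\mathcal I\rangle_{n+1}=\langle\mathcal I\rangle_n\diamond\langle\mathcal I\rangle_1$ for $n\geqslant 1$. Then $\mathrm{tri.dim}\,\mathcal T=\inf\{n\geqslant 0\mid\mathcal T=\langle T\rangle_{n+1}\text{ for some }T\in\mathcal T\}$, or $\infty$ if no such $T$ exists (with $\langle T\rangle_n=\langle\{T\}\rangle_n$). Extension dimension: for subcategories $\mathcal U_1,\mathcal U_2$ of $\Lambda\text{-}\mathrm{mod}$ let $\mathcal U_1\bullet\mathcal U_2=\mathrm{add}\{M\in\Lambda\text{-}\mathrm{mod}\mid\text{there is a short exact sequence }0\to U_1\to M\to U_2\to 0\text{ with }U_1\in\mathcal U_1, U_2\in\mathcal U_2\}$. Put $[\mathcal U]_0=0$, $[\mathcal U]_1=\mathrm{add}\,\mathcal U$, $[\mathcal U]_n=[\mathcal U]_1\bullet[\mathcal U]_{n-1}$ for $n\geqslant 2$, and $[T]_n=[\{T\}]_n$ for a module $T$. Then $\mathrm{ext.dim}\,\Lambda=\inf\{n\geqslant 0\mid\Lambda\text{-}\mathrm{mod}=[T]_{n+1}\text{ for some }T\in\Lambda\text{-}\mathrm{mod}\}$. *)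

(* Defs.v *)
From HB Require Import structures.
From mathcomp Require Import all_boot all_order all_algebra.
From mathcomp Require Import boolp classical_sets constructive_ereal.

Set Implicit Arguments.
Unset Strict Implicit.
Unset Printing Implicit Defensive.

Import Order.TTheory GRing.Theory Num.Theory.
Local Open Scope classical_set_scope.
Local Open Scope ring_scope.

(* Infimum of a set of naturals, with inf set0 = +oo; an element of \bar int. *)
Definition nat_inf (P : set nat) : \bar int :=
  if pselect (exists n, `[< P n >]) is left exP
  then ((ex_minn exP)%:Z)%:E else +oo%E.

Definition fin_gen (A : pzRingType) (M : lmodType A) : Prop :=
  exists (n : nat) (e : 'I_n -> M),
    forall x : M, exists c : 'I_n -> A, x = \sum_(i < n) c i *: e i.

Definition left_ideal (A : pzRingType) (I : set A) : Prop :=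
  [/\ I 0, forall x y, I x -> I y -> I (x + y)
    & forall a x, I x -> I (a * x)].

Definition maximal_left_ideal (A : pzRingType) (I : set A) : Prop :=
  [/\ left_ideal I, I <> setT
    & forall J, left_ideal J -> I `<=` J -> J = I \/ J = setT].

Definition jacobson_radical (A : pzRingType) : set A :=
  [set x | forall I, maximal_left_ideal I -> I x].

Definition artinian (R : comNzRingType) : Prop :=
  forall I : nat -> set R,
    (forall n, left_ideal (I n)) -> (forall n, I n.+1 `<=` I n) ->
    exists N, forall n, (N <= n)%N -> I n = I N.

Definition artin_algebra (R : comNzRingType) (A : algType R) : Prop :=
  artinian R /\ fin_gen A.

(* The notions below (add, dimension) only involve the data of an additive or
   triangulated category, not its axioms, so only the data are recorded.
   [heq] is equality of morphisms: homs are setoids, as those of D^b below are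
   formal composites modulo a congruence. *)
Record additive_data := AdditiveData {
  ob :> Type;
  mor : ob -> ob -> Type;
  heq : forall X Y, mor X Y -> mor X Y -> Prop;
  idm : forall X, mor X X;
  compm : forall X Y Z, mor Y Z -> mor X Y -> mor X Z;
  zero_ob : ob;
  dsum : ob -> ob -> ob
}.

Record triangulated_data := TriangulatedData {
  tadd :> additive_data;
  shift_ob : int -> tadd -> tadd;
  dist : forall X Y Z : tadd,
    mor X Y -> mor Y Z -> mor Z (shift_ob 1 X) -> Prop
}.

Definition is_iso (C : additive_data) (X Y : C) (f : mor X Y) : Prop :=
  exists g : mor Y X, heq (compm g f) (idm X) /\ heq (compm f g) (idm Y).

Definition isomorphic (C : additive_data) (X Y : C) : Prop :=
  exists f : mor X Y, is_iso f.

(* Full subcategories, given by their objects. (The type [set] cannot be used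
   here: the objects of A-mod live in too large a universe.) *)
Definition subcat (C : additive_data) := C -> Prop.

Definition single (C : additive_data) (X : C) : subcat C := fun Y => Y = X.

Definition zero_subcat (C : additive_data) : subcat C :=
  fun X => isomorphic X (zero_ob C).

Fixpoint dsum_fin (C : additive_data) (n : nat) : ('I_n -> C) -> C :=
  match n with
  | 0%N => fun _ => zero_ob C
  | m.+1 => fun Y => dsum (Y ord0) (dsum_fin (fun i => Y (lift ord0 i)))
  end.

Definition add (C : additive_data) (U : subcat C) : subcat C :=
  fun X => exists (X' : C) (n : nat) (Y : 'I_n -> C),
    (forall i, U (Y i)) /\ isomorphic (dsum X X') (dsum_fin Y).

Definition gen1 (T : triangulated_data) (I : subcat T) : subcat T :=
  add (fun Y => exists (X : T) (i : int), I X /\ Y = shift_ob i X).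

Definition star (T : triangulated_data) (I1 I2 : subcat T) : subcat T :=
  fun X => exists (X1 X2 : T) (u : mor X1 X) (v : mor X X2)
             (w : mor X2 (shift_ob 1 X1)),
    [/\ I1 X1, I2 X2 & dist u v w].

Definition diamond (T : triangulated_data) (I1 I2 : subcat T) : subcat T :=
  gen1 (star I1 I2).

Fixpoint gen (T : triangulated_data) (I : subcat T) (n : nat) : subcat T :=
  match n with
  | 0%N => @zero_subcat T
  | 1%N => gen1 I
  | m.+1 => diamond (gen I m) (gen1 I)
  end.

Definition tri_dim (T : triangulated_data) : \bar int :=
  nat_inf [set n | exists X : T, forall Y : T, gen (single X) n.+1 Y].

Record fgmod (A : pzRingType) := FgMod {
  fgmod_mod :> lmodType A;
  fgmodP : fin_gen fgmod_mod
}.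

Definition zero_mod (A : pzRingType) : lmodType A := 'rV[A]_0.

Lemma fin_gen_zero (A : pzRingType) : fin_gen (zero_mod A).
Proof.
exists 0%N, (fun=> 0) => x; exists (fun=> 0).
by rewrite big_ord0; apply/rowP; case.
Qed.

Lemma fin_gen_prod (A : pzRingType) (M N : lmodType A) :
  fin_gen M -> fin_gen N -> fin_gen (M * N)%type.
Proof.
move=> [m [e he]] [n [f hf]].
exists (m + n)%N, (fun i => match split i with
  | inl j => (e j, 0) | inr k => (0, f k) end) => -[x y].
have [c hc] := he x; have [d hd] := hf y.
exists (fun i => match split i with inl j => c j | inr k => d k end).
have pairsum (I : finType) (F : I -> (M * N)%type) :
    \sum_i F i = (\sum_i (F i).1, \sum_i (F i).2).
  apply: (big_ind3 (fun p x y => p = (x, y))) => //.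
    - by move=> ? ? ? ? ? ? -> ->.
    - by move=> i _; case: (F i).
rewrite pairsum; congr pair; rewrite big_split_ord /=.
- rewrite [X in _ + X]big1 ?addr0; last first.
    by move=> i _; rewrite -[rshift _ _]/(unsplit (inr i)) unsplitK /= scaler0.
  rewrite hc; apply: eq_bigr => i _.
  by rewrite -[lshift _ _]/(unsplit (inl i)) unsplitK.
- rewrite big1 ?add0r; last first.
    by move=> i _; rewrite -[lshift _ _]/(unsplit (inl i)) unsplitK /= scaler0.
  rewrite hd; apply: eq_bigr => i _.
  by rewrite -[rshift _ _]/(unsplit (inr i)) unsplitK.
Qed.

Definition zero_fgmod (A : pzRingType) : fgmod A := FgMod (fin_gen_zero A).

Definition dsum_fgmod (A : pzRingType) (M N : fgmod A) : fgmod A :=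
  FgMod (fin_gen_prod (fgmodP M) (fgmodP N)).

Definition mod_cat (A : pzRingType) : additive_data := {|
  ob := fgmod A;
  mor := fun M N => {linear M -> N};
  heq := fun M N f g => f =1 g;
  idm := fun M => idfun;
  compm := fun M N P g f => g \o f;
  zero_ob := zero_fgmod A;
  dsum := @dsum_fgmod A
|}.

Definition indecomposable (A : pzRingType) (M : mod_cat A) : Prop :=
  ~ zero_subcat M /\
  forall X Y : mod_cat A, isomorphic M (dsum X Y) ->
    zero_subcat X \/ zero_subcat Y.

Definition rep_finite (A : pzRingType) : Prop :=
  exists (n : nat) (F : 'I_n -> mod_cat A),
    forall M : mod_cat A, indecomposable M -> exists i, isomorphic M (F i).

Definition short_exact (A : pzRingType) (M' M M'' : lmodType A)
    (f : {linear M' -> M}) (g : {linear M -> M''}) : Prop :=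
  [/\ injective f, (forall z, exists y, g y = z)
    & forall y, g y = 0 <-> exists x, f x = y].

Definition bullet (A : pzRingType) (U1 U2 : subcat (mod_cat A)) :
    subcat (mod_cat A) :=
  add (fun M : mod_cat A => exists (X1 X2 : fgmod A)
        (f : {linear X1 -> (M : fgmod A)}) (g : {linear (M : fgmod A) -> X2}),
        [/\ U1 X1, U2 X2 & short_exact f g]).

Fixpoint ext_gen (A : pzRingType) (U : subcat (mod_cat A)) (n : nat) :
    subcat (mod_cat A) :=
  match n with
  | 0%N => @zero_subcat (mod_cat A)
  | 1%N => add U
  | m.+1 => bullet (add U) (ext_gen U m)
  end.

Definition ext_dim (A : pzRingType) : \bar int :=
  nat_inf [set n | exists T : mod_cat A,
    forall M : mod_cat A, ext_gen (single T) n.+1 M].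

(* [lrep_chain A s]: there is a chain A = A_0 < A_1 < ... < A_s of Artin
   R-algebras, each step being a proper, identity-preserving R-algebra
   embedding f : A_i -> A_{i+1} such that f (rad A_i) is a left ideal of
   A_{i+1}, and A_s is representation-finite. *)
Inductive lrep_chain (R : comNzRingType) : algType R -> nat -> Prop :=
| lrep_chain0 (A : algType R) : rep_finite A -> lrep_chain A 0
| lrep_chainS (A B : algType R) (f : {lrmorphism A -> B}) (s : nat) :
    artin_algebra B ->
    injective f -> (exists b : B, forall a, f a <> b) ->
    left_ideal (f @` @jacobson_radical A) ->
    lrep_chain B s -> lrep_chain A s.+1.

Definition lrep_dis (R : comNzRingType) (A : algType R) : \bar int :=
  if `[< rep_finite A >] then 0%E else nat_inf [set s | lrep_chain A s].

(* The differential X^i -> X^j is indexed by an equation i + 1 = j, so that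
   shifting degrees requires no transport along equalities in int. *)
Record bcplx (A : pzRingType) := BCplx {
  cob :> int -> lmodType A;
  cd : forall i j : int, i + 1 = j -> {linear cob i -> cob j};
  cdd : forall (i j k : int) (e : i + 1 = j) (e' : j + 1 = k) (x : cob i),
    cd e' (cd e x) = 0;
  cfg : forall i, fin_gen (cob i);
  cbounded : exists N : nat,
    forall i : int, (N < `|i|)%N -> forall x : cob i, x = 0
}.

Record chmap (A : pzRingType) (X Y : bcplx A) := ChMap {
  chfun :> forall i : int, {linear X i -> Y i};
  chcomm : forall (i j : int) (e : i + 1 = j) (x : X i),
    chfun j (cd X e x) = cd Y e (chfun i x)
}.

Definition ch_id (A : pzRingType) (X : bcplx A) : chmap X X :=
  @ChMap A X X (fun i => idfun) (fun i j e x => erefl).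

Lemma ch_comp_comm (A : pzRingType) (X Y Z : bcplx A)
    (g : chmap Y Z) (f : chmap X Y) (i j : int) (e : i + 1 = j) (x : X i) :
  (g j \o f j) (cd X e x) = cd Z e ((g i \o f i) x).
Proof. by rewrite /= !chcomm. Qed.

Definition ch_comp (A : pzRingType) (X Y Z : bcplx A)
    (g : chmap Y Z) (f : chmap X Y) : chmap X Z :=
  @ChMap A X Z (fun i => g i \o f i) (ch_comp_comm g f).

Definition homotopic (A : pzRingType) (X Y : bcplx A) (f g : chmap X Y) :
    Prop :=
  exists h : forall j i : int, i + 1 = j -> {linear X j -> Y i},
    forall (i j k : int) (e : i + 1 = j) (e' : j + 1 = k) (x : X j),
      f j x - g j x = cd Y e (h j i e x) + h k j e' (cd X e' x).

Definition cocycle (A : pzRingType) (X : bcplx A) (i : int) : set (X i) :=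
  [set x | forall j (e : i + 1 = j), cd X e x = 0].

Definition coboundary (A : pzRingType) (X : bcplx A) (i : int) : set (X i) :=
  [set x | exists (j : int) (e : j + 1 = i) (y : X j), x = cd X e y].

(* H^i(f) is injective and surjective for every i. *)
Definition quasi_iso (A : pzRingType) (X Y : bcplx A) (f : chmap X Y) : Prop :=
  forall i : int,
    (forall x : X i, cocycle x -> coboundary (f i x) -> coboundary x) /\
    (forall y : Y i, cocycle y ->
       exists x : X i, cocycle x /\ coboundary (y - f i x)).

Section ZeroDsum.
Context (A : pzRingType).

Definition zero_cplx_d (i j : int) (e : i + 1 = j) :
  {linear zero_mod A -> zero_mod A} := idfun.

Fact zero_cplx_dd (i j k : int) (e : i + 1 = j) (e' : j + 1 = k)
  (x : zero_mod A) : zero_cplx_d e' (zero_cplx_d e x) = 0.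
Proof. by apply/rowP; case. Qed.

Fact zero_cplx_bounded : exists N : nat,
  forall i : int, (N < `|i|)%N -> forall x : zero_mod A, x = 0.
Proof. by exists 0%N => i _ x; apply/rowP; case. Qed.

Definition zero_cplx : bcplx A :=
  @BCplx A (fun=> zero_mod A) zero_cplx_d zero_cplx_dd
    (fun=> fin_gen_zero A) zero_cplx_bounded.

Context (X Y : bcplx A).

Definition dsum_cplx_fun (i j : int) (e : i + 1 = j)
  (p : (X i * Y i)%type) : (X j * Y j)%type := (cd X e p.1, cd Y e p.2).

Fact dsum_cplx_linear (i j : int) (e : i + 1 = j) : linear (dsum_cplx_fun e).
Proof.
by move=> a u v; rewrite /dsum_cplx_fun /= !linearP.
Qed.

HB.instance Definition _ (i j : int) (e : i + 1 = j) :=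
  GRing.isLinear.Build A _ _ _ (dsum_cplx_fun e) (dsum_cplx_linear e).

Fact dsum_cplx_dd (i j k : int) (e : i + 1 = j) (e' : j + 1 = k)
  (p : (X i * Y i)%type) : dsum_cplx_fun e' (dsum_cplx_fun e p) = 0.
Proof. by rewrite /dsum_cplx_fun /= !cdd. Qed.

Fact dsum_cplx_bounded : exists N : nat,
  forall i : int, (N < `|i|)%N -> forall p : (X i * Y i)%type, p = 0.
Proof.
have [M hM] := cbounded X; have [N hN] := cbounded Y.
exists (maxn M N) => i; rewrite gtn_max => /andP[hi hi'] [x y].
by rewrite (hM _ hi x) (hN _ hi' y).
Qed.

Definition dsum_cplx : bcplx A :=
  @BCplx A (fun i => (X i * Y i)%type) (fun i j e => dsum_cplx_fun e)
    dsum_cplx_dd (fun i => fin_gen_prod (cfg X i) (cfg Y i))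
    dsum_cplx_bounded.

End ZeroDsum.

(* X[k]^i = X^(i+k), with differential (-1)^k d. *)

Fact shift_eq (k i j : int) : i + 1 = j -> i + k + 1 = j + k.
Proof. by move<-; rewrite addrAC. Qed.

Section Shift.
Context (A : pzRingType) (k : int).

Definition shift_d_fun (X : bcplx A) (i j : int) (e : i + 1 = j)
  (x : X (i + k)) : X (j + k) := (-1) ^+ `|k|%N *: cd X (shift_eq k e) x.

Fact shift_d_linear (X : bcplx A) (i j : int) (e : i + 1 = j) :
  linear (@shift_d_fun X i j e).
Proof.
move=> a u v; rewrite /shift_d_fun linearP scalerDr !scalerA.
by rewrite (commr_sign a).
Qed.

HB.instance Definition _ (X : bcplx A) (i j : int) (e : i + 1 = j) :=
  GRing.isLinear.Build A _ _ _ (@shift_d_fun X i j e) (shift_d_linear e).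

Fact shift_dd (X : bcplx A) (i j l : int) (e : i + 1 = j) (e' : j + 1 = l)
  (x : X (i + k)) : shift_d_fun e' (shift_d_fun e x) = 0.
Proof. by rewrite /shift_d_fun linearZ /= cdd !scaler0. Qed.

Fact shift_bounded (X : bcplx A) : exists N : nat,
  forall i : int, (N < `|i|)%N -> forall x : X (i + k), x = 0.
Proof.
have [N hN] := cbounded X; exists (N + `|k|)%N => i hi; apply: hN.
rewrite -(ltn_add2r `|k|%N); apply: leq_trans hi _.
by rewrite -lez_nat PoszD !abszE -{1}(addrK k i) ler_normB.
Qed.

Definition shift_cplx (X : bcplx A) : bcplx A :=
  @BCplx A (fun i => X (i + k)) (fun i j e => @shift_d_fun X i j e)
    (@shift_dd X) (fun i => cfg X (i + k)) (@shift_bounded X).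

Fact shift_comm (X Y : bcplx A) (f : chmap X Y) (i j : int) (e : i + 1 = j)
    (x : shift_cplx X i) :
  f (j + k) (cd (shift_cplx X) e x) = cd (shift_cplx Y) e (f (i + k) x).
Proof. by rewrite /= /shift_d_fun linearZ /= chcomm. Qed.

Definition shift_map (X Y : bcplx A) (f : chmap X Y) :
    chmap (shift_cplx X) (shift_cplx Y) :=
  @ChMap A (shift_cplx X) (shift_cplx Y) (fun i => f (i + k))
    (@shift_comm X Y f).

End Shift.

Lemma shift_quasi_iso (A : pzRingType) (k : int) (X Y : bcplx A)
  (f : chmap X Y) : quasi_iso f -> quasi_iso (shift_map k f).
Proof.
have sgK (Z : lmodType A) (z : Z) :
    (-1) ^+ `|k|%N *: ((-1) ^+ `|k|%N *: z) = z.
  by rewrite scalerA -expr2 sqrr_sign scale1r.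
have cocE (Z : bcplx A) (i : int) (z : Z (i + k)) :
    @cocycle A (shift_cplx k Z) i z <-> @cocycle A Z (i + k) z.
  split=> [hz j e | hz j e]; last by rewrite /= /shift_d_fun hz scaler0.
  have e' : i + 1 = j - k by rewrite -e [i + k + 1]addrAC addrK.
  have := hz _ e'; rewrite /= /shift_d_fun => /(congr1 (fun t => (-1) ^+ `|k|%N *: t)).
  rewrite sgK scaler0; move: (shift_eq k e').
  by rewrite (subrK k j) => e''; rewrite (Prop_irrelevance e'' e).
have cobE (Z : bcplx A) (i : int) (z : Z (i + k)) :
    @coboundary A (shift_cplx k Z) i z <-> @coboundary A Z (i + k) z.
  split=> [[j [e [y ->]]] | [j [e [y ->]]]].
    exists (j + k), (shift_eq k e), ((-1) ^+ `|k|%N *: y).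
    by rewrite linearZ.
  have [j' ej] : exists j', j' + k = j by exists (j - k); rewrite subrK.
  case: _ / ej e y => e y; have e' : j' + 1 = i.
    by apply: (addIr k); rewrite addrAC.
  exists j', e', ((-1) ^+ `|k|%N *: y); rewrite /= /shift_d_fun linearZ /= sgK.
  by rewrite (Prop_irrelevance (shift_eq k e') e).
move=> qf i; have [inj surj] := qf (i + k); split.
  by move=> x /cocE hx /cobE hfx; apply/cobE/inj.
move=> y /cocE /surj [x [hx hy]].
by exists x; split; [apply/cocE | apply/cobE].
Qed.

Section Cone.
Context (A : pzRingType) (X Y : bcplx A) (f : chmap X Y).

(* cone(f)^i = X^(i+1) + Y^i with d (x, y) = (- d x, f x + d y). *)
Definition cone_d_fun (i j : int) (e : i + 1 = j) :
    (X (i + 1)%R * Y i)%type -> (X (j + 1)%R * Y j)%type :=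
  match e in _ = j0 return
    (X (i + 1)%R * Y i)%type -> (X (j0 + 1)%R * Y j0)%type with
  | erefl => fun p =>
      (- cd X (erefl (i + 1 + 1)) p.1, f (i + 1) p.1 + cd Y erefl p.2)
  end.

Fact cone_d_linear (i j : int) (e : i + 1 = j) : linear (cone_d_fun e).
Proof.
case: _ / e => a u v /=; congr pair; rewrite /= !linearP ?opprD ?scalerN //.
by rewrite scalerDr addrACA.
Qed.

HB.instance Definition _ (i j : int) (e : i + 1 = j) :=
  GRing.isLinear.Build A _ _ _ (cone_d_fun e) (cone_d_linear e).

Fact cone_dd (i j k : int) (e : i + 1 = j) (e' : j + 1 = k)
  (p : (X (i + 1)%R * Y i)%type) : cone_d_fun e' (cone_d_fun e p) = 0.
Proof.
case: _ / e' => /=; case: _ / e p => -[x y] /=; congr pair => /=.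
  by rewrite linearN /= cdd !oppr0.
by rewrite !linearD !linearN /= chcomm cdd addr0 addNr.
Qed.

Fact cone_bounded : exists N : nat, forall i : int, (N < `|i|)%N ->
  forall p : (X (i + 1)%R * Y i)%type, p = 0.
Proof.
have [M hM] := shift_bounded 1 X; have [N hN] := cbounded Y.
exists (maxn M N) => i; rewrite gtn_max => /andP[hi hi'] [x y].
by rewrite (hM _ hi x) (hN _ hi' y).
Qed.

Definition cone : bcplx A :=
  @BCplx A (fun i => (X (i + 1)%R * Y i)%type) (fun i j e => cone_d_fun e)
    cone_dd (fun i => fin_gen_prod (cfg X (i + 1)) (cfg Y i)) cone_bounded.

Definition cone_in_fun (i : int) (y : Y i) : (X (i + 1)%R * Y i)%type := (0, y).

Fact cone_in_linear (i : int) : linear (@cone_in_fun i).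
Proof. by move=> a u v; congr pair; rewrite /= scaler0 addr0. Qed.

HB.instance Definition _ (i : int) :=
  GRing.isLinear.Build A _ _ _ (@cone_in_fun i) (@cone_in_linear i).

Fact cone_in_comm (i j : int) (e : i + 1 = j) (y : Y i) :
  cone_in_fun (cd Y e y) = cd cone e (cone_in_fun y).
Proof.
by case: _ / e; congr pair => /=; rewrite linear0 ?oppr0 ?add0r.
Qed.

Definition cone_in : chmap Y cone :=
  @ChMap A Y cone (fun i => @cone_in_fun i) cone_in_comm.

Definition cone_out_fun (i : int) : {linear (X (i + 1)%R * Y i)%type -> X (i + 1)} :=
  fst.

Fact cone_out_comm (i j : int) (e : i + 1 = j) (p : cone i) :
  cone_out_fun j (cd cone e p) = cd (shift_cplx 1 X) e (cone_out_fun i p).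
Proof.
case: _ / e => /=; rewrite /shift_d_fun expr1 scaleN1r; congr (- _).
by rewrite (Prop_irrelevance (shift_eq 1 erefl) erefl).
Qed.

Definition cone_out : chmap cone (shift_cplx 1 X) :=
  @ChMap A cone (shift_cplx 1 X) cone_out_fun cone_out_comm.

End Cone.

(* D^b(A-mod) is the localization of the homotopy category of bounded
   complexes at the quasi-isomorphisms; its zero object and biproducts are
   those of complexes. Morphisms are the formal composites of chain maps and
   formal inverses of quasi-isomorphisms, and [Deq] is the congruence generated
   by the localization relations. *)
Inductive Dhom (A : pzRingType) : bcplx A -> bcplx A -> Type :=
| Dmap (X Y : bcplx A) (f : chmap X Y) : Dhom X Y
| Dinv (X Y : bcplx A) (s : chmap X Y) (qs : quasi_iso s) : Dhom Y X
| Dcomp (X Y Z : bcplx A) (g : Dhom Y Z) (f : Dhom X Y) : Dhom X Z.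

Inductive Deq (A : pzRingType) :
    forall X Y : bcplx A, Dhom X Y -> Dhom X Y -> Prop :=
| Deq_refl (X Y : bcplx A) (f : Dhom X Y) : Deq f f
| Deq_sym (X Y : bcplx A) (f g : Dhom X Y) : Deq f g -> Deq g f
| Deq_trans (X Y : bcplx A) (f g h : Dhom X Y) :
    Deq f g -> Deq g h -> Deq f h
| Deq_comp (X Y Z : bcplx A) (g g' : Dhom Y Z) (f f' : Dhom X Y) :
    Deq g g' -> Deq f f' -> Deq (Dcomp g f) (Dcomp g' f')
| Deq_assoc (W X Y Z : bcplx A) (h : Dhom Y Z) (g : Dhom X Y) (f : Dhom W X) :
    Deq (Dcomp h (Dcomp g f)) (Dcomp (Dcomp h g) f)
| Deq_idl (X Y : bcplx A) (f : Dhom X Y) : Deq (Dcomp (Dmap (ch_id Y)) f) f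
| Deq_idr (X Y : bcplx A) (f : Dhom X Y) : Deq (Dcomp f (Dmap (ch_id X))) f
| Deq_map_comp (X Y Z : bcplx A) (g : chmap Y Z) (f : chmap X Y) :
    Deq (Dcomp (Dmap g) (Dmap f)) (Dmap (ch_comp g f))
| Deq_homotopic (X Y : bcplx A) (f g : chmap X Y) :
    homotopic f g -> Deq (Dmap f) (Dmap g)
| Deq_invl (X Y : bcplx A) (s : chmap X Y) (qs : quasi_iso s) :
    Deq (Dcomp (Dinv qs) (Dmap s)) (Dmap (ch_id X))
| Deq_invr (X Y : bcplx A) (s : chmap X Y) (qs : quasi_iso s) :
    Deq (Dcomp (Dmap s) (Dinv qs)) (Dmap (ch_id Y)).

Fixpoint Dshift (A : pzRingType) (k : int) (X Y : bcplx A) (f : Dhom X Y) :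
    Dhom (shift_cplx k X) (shift_cplx k Y) :=
  match f with
  | Dmap _ _ f => Dmap (shift_map k f)
  | Dinv _ _ _ qs => Dinv (shift_quasi_iso k qs)
  | Dcomp _ _ _ g f => Dcomp (Dshift k g) (Dshift k f)
  end.

Definition Db_add (A : pzRingType) : additive_data := {|
  ob := bcplx A;
  mor := @Dhom A;
  heq := @Deq A;
  idm := fun X => Dmap (ch_id X);
  compm := @Dcomp A;
  zero_ob := zero_cplx A;
  dsum := @dsum_cplx A
|}.

(* Triangles isomorphic in D^b to a standard one X' -> Y' -> cone f -> X'[1]. *)
Definition Db_dist (A : pzRingType) (X Y Z : Db_add A)
    (u : mor X Y) (v : mor Y Z) (w : mor Z (shift_cplx 1 X : Db_add A)) :
    Prop :=
  exists (X' Y' : bcplx A) (f : chmap X' Y')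
    (a : @mor (Db_add A) X' X) (b : @mor (Db_add A) Y' Y)
    (c : @mor (Db_add A) (cone f) Z),
    [/\ is_iso a, is_iso b & is_iso c] /\
    [/\ Deq (Dcomp b (Dmap f)) (Dcomp u a),
        Deq (Dcomp c (Dmap (cone_in f))) (Dcomp v b)
      & Deq (Dcomp (Dshift 1 a) (Dmap (cone_out f))) (Dcomp w c)].

Definition Db (A : pzRingType) : triangulated_data := {|
  tadd := Db_add A;
  shift_ob := @shift_cplx A;
  dist := @Db_dist A
|}.

(* Main.v *)
Require Import Defs.
From HB Require Import structures.
From mathcomp Require Import all_boot all_order all_algebra.
From mathcomp Require Import boolp classical_sets constructive_ereal zify.

Set Implicit Arguments.
Unset Strict Implicit.
Unset Printing Implicit Defensive.

Import Order.TTheory GRing.Theory Num.Theory.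
Local Open Scope classical_set_scope.
Local Open Scope ring_scope.

(** Fix a chain A = A_0 < A_1 < ... < A_s as in the definition of lrep.dis, and
    write J_i for the radical of A_i.  Everything rests on one remark about
    torsionless modules, that is, submodules N of a free module A^n: if the
    radical J of A is a left ideal of a larger ring B, then J N, computed
    inside B^n, is a B-submodule of B^n, since b (j x) = (b j) x with b j again
    in J.  So J N is a B-module, torsionless over B, and N / J N is a
    semisimple A-module.  Iterating along the chain filters N by s semisimple
    quotients, over A_0, ..., A_(s-1), and one last module over the
    representation-finite algebra A_s.  All these pieces, restricted to A, are
    summands of powers of a single module T that depends only on the chain:
    this is [torsionless_mfilt].  The action of B on J N does not depend on the
    embedding and every A-linear map N -> N' is B-linear on the radical parts,
    so that the same filtration exists for complexes with torsionless
    components ([torsionless_cfilt]); a complex over A_s needs two pieces, its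
    cycles and the quotient by them, and gives s + 2 pieces in all.

    For the derived category, every bounded complex X is quasi-isomorphic to
    one with torsionless components ([torsionless_cover]), and short exact
    sequences of complexes are distinguished triangles ([star_ses]).  The s + 2
    pieces are, up to quasi-isomorphism, complexes with zero differential made
    of summands of powers of T, hence summands of sums of shifts of T.  So X
    lies in the (s + 2)-nd step generated by T, and tri.dim is at most s + 1,
    which is at most 2 s + 1.

    For the extension dimension, a module M is P / N with P free and N
    torsionless, and the filtration of N has to be turned into one of a
    cosyzygy of N.  This needs a finitely generated module E that contains T
    and is injective with respect to finitely generated modules.  Such an E is
    a maximal essential extension of T ([relinj_hull]); it exists because, A
    being finite over the artinian ring R, the lengths over R of the essential
    extensions of T are bounded.  The horseshoe lemma [cosyzygy] then embeds N,
    up to a summand V of a power of T, into an injective I whose cokernel Q has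
    s + 1 pieces in add (E / T), and 0 -> P + V -> M + I -> Q -> 0 is
    exact.  So M is a summand of a module with s + 2 pieces.

    The artinian ring theory used on the way (nilpotence of the radical in the
    form of Nakayama's lemma, complements modulo the radical, the
    Hopkins-Levitzki theorem, existence of decompositions into indecomposables)
    is proved with Zorn's lemma and minimal elements in families of submodules,
    the latter being sets closed under the module operations. *)

(** * Submodules, quotients and factorisation of linear maps *)

Definition mklin (A : pzRingType) (U V : lmodType A) (f : U -> V)
    (fl : linear f) : {linear U -> V} :=
  HB.pack f (GRing.isLinear.Build A U V *:%R f fl).

Definition submod (A : pzRingType) (M : lmodType A) (U : set M) : Prop :=
  [/\ U 0, forall x y, U x -> U y -> U (x + y) & forall a x, U x -> U (a *: x)].

Section Submod.
Context (A : pzRingType) (M : lmodType A).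
Implicit Types U V W : set M.

Lemma submod0 U : submod U -> U 0. Proof. by case. Qed.
Lemma submodD U x y : submod U -> U x -> U y -> U (x + y).
Proof. by case=> _ + _; apply. Qed.
Lemma submodZ U a x : submod U -> U x -> U (a *: x).
Proof. by case=> _ _; apply. Qed.
Lemma submodN U x : submod U -> U x -> U (- x).
Proof. by move=> hU /(submodZ (-1) hU); rewrite scaleN1r. Qed.
Lemma submodB U x y : submod U -> U x -> U y -> U (x - y).
Proof. by move=> hU hx /(submodN hU); apply: submodD. Qed.
Lemma submodT : submod [set: M]. Proof. by []. Qed.
Lemma submod_zero : submod [set 0 : M].
Proof.
by split=> [//|x y -> ->|a x ->]; rewrite /set1 /= ?addr0 ?scaler0.
Qed.
Lemma submodI U V : submod U -> submod V -> submod (U `&` V).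
Proof.
move=> hU hV; split=> [|x y [? ?] [? ?]|a x [? ?]];
  split; by [apply: submod0|apply: submodD|apply: submodZ].
Qed.

Definition addset U V : set M := [set x | exists u v, [/\ U u, V v & x = u + v]].

Lemma submod_addset U V : submod U -> submod V -> submod (addset U V).
Proof.
move=> hU hV; split.
- by exists 0, 0; split; rewrite ?addr0 //; apply: submod0.
- move=> _ _ [u [v [? ? ->]]] [u' [v' [? ? ->]]].
  by exists (u + u'), (v + v'); split; rewrite 1?addrACA //; apply: submodD.
- move=> a _ [u [v [? ? ->]]].
  by exists (a *: u), (a *: v); split; rewrite ?scalerDr //; apply: submodZ.
Qed.
Lemma addsetl U V : submod V -> U `<=` addset U V.
Proof. by move=> hV x Ux; exists x, 0; rewrite addr0; split=> //; apply: submod0. Qed.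
Lemma addsetr U V : submod U -> V `<=` addset U V.
Proof. by move=> hV x Ux; exists 0, x; rewrite add0r; split=> //; apply: submod0. Qed.
Lemma addset_sub U V W : submod W -> U `<=` W -> V `<=` W -> addset U V `<=` W.
Proof. by move=> hW hU hV _ [u [v [/hU ? /hV ? ->]]]; apply: submodD. Qed.

Definition cyc (x : M) : set M := [set y | exists a, y = a *: x].

Lemma submod_cyc x : submod (cyc x).
Proof.
split; first by exists 0; rewrite scale0r.
- by move=> _ _ [a ->] [b ->]; exists (a + b); rewrite scalerDl.
- by move=> a _ [b ->]; exists (a * b); rewrite scalerA.
Qed.
Lemma cyc_id x : cyc x x. Proof. by exists 1; rewrite scale1r. Qed.
Lemma cyc_sub x U : submod U -> U x -> cyc x `<=` U.
Proof. by move=> hU Ux _ [a ->]; apply: submodZ. Qed.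

End Submod.

Section SubmodMaps.
Context (A : pzRingType) (M N : lmodType A) (g : {linear M -> N}).

Lemma submod_image (U : set M) : submod U -> submod (g @` U).
Proof.
move=> hU; split; first by exists 0; rewrite ?linear0 //; apply: submod0.
- move=> _ _ [x Ux <-] [y Uy <-]; exists (x + y); last exact: linearD.
  exact: submodD.
- move=> a _ [x Ux <-]; exists (a *: x); last exact: linearZ.
  exact: submodZ.
Qed.
Lemma submod_preimage (V : set N) : submod V -> submod (g @^-1` V).
Proof.
move=> hV; split; rewrite /preimage /=; first by rewrite linear0; apply: submod0.
- by move=> x y ? ?; rewrite linearD; apply: submodD.
- by move=> a x ?; rewrite linearZ; apply: submodZ.
Qed.
Lemma submod_ker : submod [set x | g x = 0].
Proof. exact: (submod_preimage (submod_zero N)). Qed.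
End SubmodMaps.

(** Bundled submodules, so that the carrier types [sub] and [quo] below can be
    given module structures. *)
Record smod (A : pzRingType) (M : lmodType A) := Smod {
  sset : set M;
  smodP : submod sset
}.

Section SubType.
Context (A : pzRingType) (M : lmodType A) (U : smod M).

Record sub := Sub { subval : M; subvalP : `[< sset U subval >] }.
HB.instance Definition _ := [isSub for subval].
HB.instance Definition _ := [Choice of sub by <:].

Lemma sub_in (x : sub) : sset U (subval x).
Proof. by apply/asboolP; case: x. Qed.
Definition mksub (x : M) (h : sset U x) : sub := Sub (asboolT h).

Definition sub0 : sub := mksub (submod0 (smodP U)).
Definition subopp (x : sub) : sub := mksub (submodN (smodP U) (sub_in x)).
Definition subadd (x y : sub) : sub :=
  mksub (submodD (smodP U) (sub_in x) (sub_in y)).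
Definition subscale (a : A) (x : sub) : sub :=
  mksub (submodZ a (smodP U) (sub_in x)).

Fact subaddA : associative subadd.
Proof. by move=> x y z; apply: val_inj; rewrite /= addrA. Qed.
Fact subaddC : commutative subadd.
Proof. by move=> x y; apply: val_inj; rewrite /= addrC. Qed.
Fact subadd0 : left_id sub0 subadd.
Proof. by move=> x; apply: val_inj; rewrite /= add0r. Qed.
Fact subaddN : left_inverse sub0 subopp subadd.
Proof. by move=> x; apply: val_inj; rewrite /= addNr. Qed.
HB.instance Definition _ :=
  GRing.isZmodule.Build sub subaddA subaddC subadd0 subaddN.

Fact subscaleA a b v : subscale a (subscale b v) = subscale (a * b) v.
Proof. by apply: val_inj; rewrite /= scalerA. Qed.
Fact subscale1 : left_id 1 subscale.
Proof. by move=> x; apply: val_inj; rewrite /= scale1r. Qed.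
Fact subscaleDr : right_distributive subscale +%R.
Proof. by move=> a x y; apply: val_inj; rewrite /= scalerDr. Qed.
Fact subscaleDl v : {morph subscale^~ v : a b / a + b}.
Proof. by move=> a b; apply: val_inj; rewrite /= scalerDl. Qed.
HB.instance Definition _ :=
  GRing.Zmodule_isLmodule.Build A sub subscaleA subscale1 subscaleDr subscaleDl.

Fact subval_linear : linear subval. Proof. by []. Qed.
HB.instance Definition _ := GRing.isLinear.Build A sub M *:%R subval subval_linear.

Lemma subval_inj : injective subval. Proof. exact: val_inj. Qed.
End SubType.

Section Quotient.
Context (A : pzRingType) (M : lmodType A) (U : smod M).
Let hU := smodP U.

(** A chosen representative of the coset of x; cosets are encoded by these
    canonical representatives, which makes the quotient a subtype of M. *)
Definition qrep (x : M) : M := xget 0 [set y | sset U (y - x)].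

Lemma qrepP x : sset U (qrep x - x).
Proof. by apply: (@xgetPex _ 0 [set y | sset U (y - x)]); exists x; rewrite /= subrr; apply: submod0. Qed.
Lemma qrep_eq x y : sset U (x - y) -> qrep x = qrep y.
Proof.
move=> h; rewrite /qrep; congr xget; apply/seteqP; split=> z /= hz.
  by have := submodD hU hz h; rewrite addrA subrK.
by have := submodB hU hz h; rewrite opprB addrA subrK.
Qed.
Lemma qrepK x : qrep (qrep x) = qrep x.
Proof. exact/qrep_eq/qrepP. Qed.

Record quo := Quo { quoval : M; quovalP : qrep quoval == quoval }.
HB.instance Definition _ := [isSub for quoval].
HB.instance Definition _ := [Choice of quo by <:].

Definition qpi (x : M) : quo := Quo (introT eqP (qrepK x)).

Lemma qpi_eq x y : qpi x = qpi y <-> sset U (x - y).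
Proof.
split=> [/(congr1 quoval)/= e|h]; last by apply: val_inj; apply: qrep_eq.
have := submodB hU (qrepP y) (qrepP x); rewrite e.
by rewrite opprB addrC addrA subrK.
Qed.
Lemma qpiK q : qpi (quoval q) = q.
Proof. by apply: val_inj => /=; apply/eqP; case: q. Qed.
Definition quoadd (p q : quo) := qpi (quoval p + quoval q).
Definition quoopp (p : quo) := qpi (- quoval p).
Definition quoscale (a : A) (p : quo) := qpi (a *: quoval p).

Lemma qpiD x y : qpi (x + y) = quoadd (qpi x) (qpi y).
Proof.
apply/qpi_eq; have := submodN hU (submodD hU (qrepP x) (qrepP y)).
by rewrite addrACA -opprD opprB.
Qed.
Lemma qpiN x : qpi (- x) = quoopp (qpi x).
Proof.
by apply/qpi_eq; have := qrepP x; rewrite opprK addrC.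
Qed.
Lemma qpiZ a x : qpi (a *: x) = quoscale a (qpi x).
Proof.
apply/qpi_eq; have := submodZ a hU (submodN hU (qrepP x)).
by rewrite opprB scalerBr.
Qed.

Fact quoaddA : associative quoadd.
Proof.
move=> x y z; rewrite -(qpiK x) -(qpiK y) -(qpiK z).
by rewrite -!qpiD addrA.
Qed.
Fact quoaddC : commutative quoadd.
Proof. by move=> x y; rewrite /quoadd addrC. Qed.
Fact quoadd0 : left_id (qpi 0) quoadd.
Proof. by move=> x; rewrite -(qpiK x) -qpiD add0r. Qed.
Fact quoaddN : left_inverse (qpi 0) quoopp quoadd.
Proof. by move=> x; rewrite -(qpiK x) -qpiN -qpiD addNr. Qed.
HB.instance Definition _ :=
  GRing.isZmodule.Build quo quoaddA quoaddC quoadd0 quoaddN.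

Lemma qpi_add x y : qpi x + qpi y = qpi (x + y).
Proof. by rewrite qpiD. Qed.

Fact quoscaleA a b v : quoscale a (quoscale b v) = quoscale (a * b) v.
Proof. by rewrite -(qpiK v) -!qpiZ scalerA. Qed.
Fact quoscale1 : left_id 1 quoscale.
Proof. by move=> x; rewrite -(qpiK x) -qpiZ scale1r. Qed.
Fact quoscaleDr : right_distributive quoscale +%R.
Proof.
by move=> a x y; rewrite -(qpiK x) -(qpiK y) qpi_add -!qpiZ qpi_add scalerDr.
Qed.
Fact quoscaleDl v : {morph quoscale^~ v : a b / a + b}.
Proof. by move=> a b; rewrite -(qpiK v) -!qpiZ qpi_add scalerDl. Qed.
HB.instance Definition _ :=
  GRing.Zmodule_isLmodule.Build A quo quoscaleA quoscale1 quoscaleDr quoscaleDl.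

Fact qpi_linear : linear qpi.
Proof. by move=> a x y; rewrite -qpi_add qpiZ. Qed.
HB.instance Definition _ := GRing.isLinear.Build A M quo *:%R qpi qpi_linear.

Lemma qpi_eq0 x : qpi x = 0 <-> sset U x.
Proof. by rewrite -(linear0 qpi) qpi_eq subr0. Qed.
Lemma qpi_surj q : exists x, qpi x = q.
Proof. by exists (quoval q); apply: qpiK. Qed.
End Quotient.

Lemma sub_quo_exact (A : pzRingType) (M : lmodType A) (U : smod M) :
  short_exact (@subval A M U) (@qpi A M U).
Proof.
split; [exact: subval_inj|exact: qpi_surj|].
move=> y; rewrite qpi_eq0; split=> [h|[x <-]]; last exact: sub_in.
by exists (mksub h).
Qed.

Section Factor.
Context (A : pzRingType).

Lemma lin_inj (U V : lmodType A) (f : {linear U -> V}) :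
  (forall x, f x = 0 -> x = 0) -> injective f.
Proof. by move=> h x y e; apply/subr0_eq/h; rewrite linearB e subrr. Qed.

Lemma factor_inj (K M N : lmodType A) (i : {linear K -> M}) (g : {linear N -> M}) :
  injective i -> (forall x, exists y, i y = g x) ->
  {h : {linear N -> K} | forall x, i (h x) = g x}.
Proof.
move=> ii hg; have [h hh] := choice hg.
have hl : linear h by move=> a x y; apply: ii; rewrite linearP !hh linearP.
by exists (mklin hl).
Qed.

Lemma factor_surj (M Q N : lmodType A) (p : {linear M -> Q}) (g : {linear M -> N}) :
  (forall z, exists y, p y = z) -> (forall x, p x = 0 -> g x = 0) ->
  {h : {linear Q -> N} | forall x, h (p x) = g x}.
Proof.
move=> ps hk; have [s hs] := choice ps.
have e x y : p x = p y -> g x = g y.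
  by move=> exy; apply/subr0_eq; rewrite -linearB hk // linearB exy subrr.
have hl : linear (g \o s).
  by move=> a x y /=; rewrite -linearP; apply: e; rewrite linearP !hs.
by exists (mklin hl) => x /=; apply: e.
Qed.

Lemma inv_bij (M N : lmodType A) (f : {linear M -> N}) :
  injective f -> (forall z, exists y, f y = z) ->
  {g : {linear N -> M} | cancel f g /\ cancel g f}.
Proof.
move=> fi fs; have [g hg] := factor_inj (g := @idfun N) fi fs.
by exists g; split=> // x; apply: fi; rewrite hg.
Qed.
End Factor.

(** * Descending chains and finite generation *)

Definition left_artinian (A : pzRingType) := forall I : nat -> set A,
  (forall n, left_ideal (I n)) -> (forall n, I n.+1 `<=` I n) ->
  exists N, forall n, (N <= n)%N -> I n = I N.

Section Dcc.
Context (A : pzRingType) (M : lmodType A).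
Implicit Types U V W : set M.

Definition dcc_on V := forall U : nat -> set M,
  (forall n, submod (U n)) -> (forall n, U n.+1 `<=` U n) ->
  (forall n, U n `<=` V) -> exists N, forall n, (N <= n)%N -> U n = U N.

Definition dcc := forall U : nat -> set M,
  (forall n, submod (U n)) -> (forall n, U n.+1 `<=` U n) ->
  exists N, forall n, (N <= n)%N -> U n = U N.

(** The form in which the descending chain condition is used: were there no
    minimal element, choice would give an infinite strictly descending chain. *)
Lemma dcc_min : dcc -> forall P : set M -> Prop,
  (exists U, submod U /\ P U) ->
  exists U, [/\ submod U, P U & forall V, submod V -> P V -> V `<=` U -> U `<=` V].
Proof.
move=> hd P [U0 [hU0 PU0]]; apply: contrapT => hn.
have next U : exists V, submod U /\ P U ->
    [/\ submod V /\ P V, V `<=` U & ~ U `<=` V].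
  have [[hU PU]|hU] := pselect (submod U /\ P U); last by exists U.
  apply: contrapT => hV; apply: hn; exists U; split=> // V sV PV VU.
  apply: contrapT => UV; apply: hV; exists V; split=> //.
have [f hf] := choice next.
have good n : submod (iter n f U0) /\ P (iter n f U0).
  by elim: n => //= n /hf[].
have [N hN] := hd _ (fun n => (good n).1) (fun n => let: And3 _ h _ := hf _ (good n) in h).
by have [_ _] := hf _ (good N); apply; rewrite -[f _]/(iter N.+1 f U0) (hN N.+1).
Qed.

Definition span (e : nat -> M) n : set M :=
  [set x | exists c : nat -> A, x = \sum_(i < n) c i *: e i].

Lemma submod_span e n : submod (span e n).
Proof.
split; first by exists (fun=> 0); rewrite big1 // => i _; rewrite scale0r.
- move=> _ _ [c ->] [d ->]; exists (fun i => c i + d i).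
  by rewrite -big_split; apply: eq_bigr => i _; rewrite scalerDl.
- move=> a _ [c ->]; exists (fun i => a * c i).
  by rewrite scaler_sumr; apply: eq_bigr => i _; rewrite scalerA.
Qed.

Lemma span0 e : span e 0 = [set 0].
Proof.
apply/seteqP; split=> x; first by case=> c ->; rewrite big_ord0.
by move=> ->; exists (fun=> 0); rewrite big_ord0.
Qed.

Lemma spanS e n : span e n.+1 = addset (span e n) (cyc (e n)).
Proof.
apply/seteqP; split=> x.
  case=> c ->; rewrite big_ord_recr /=.
  by exists (\sum_(i < n) c i *: e i), (c n *: e n); split=> //; [exists c|exists (c n)].
case=> _ [_ [[c ->] [a ->] ->]].
exists (fun i => if i == n then a else c i); rewrite big_ord_recr /= eqxx.
by congr (_ + _); apply: eq_bigr => i _; rewrite ltn_eqF.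
Qed.

Lemma span_in e n i : (i < n)%N -> span e n (e i).
Proof.
move=> lin; exists (fun j => (j == i)%:R).
rewrite (bigD1 (Ordinal lin)) //= eqxx scale1r big1 ?addr0 // => j /eqP ji.
by case: eqP => [e'|]; rewrite ?scale0r //; case: ji; apply: val_inj.
Qed.

Definition fgset V := exists n e, V = span e n.

Lemma fin_genP : fin_gen M <-> fgset setT.
Proof.
split=> [[n [e he]]|[n [e he]]].
  exists n, (fun i => if insub i is Some j then e j else 0).
  apply/seteqP; split=> // x _; have [c ->] := he x.
  exists (fun i => if insub i is Some j then c j else 0).
  by apply: eq_bigr => i _; rewrite valK.
exists n, (fun i => e i) => x; have : setT x by [].
by rewrite he => -[c ->]; exists (fun i => c i).
Qed.

(** The step U_n of a chain below V + A e is determined by U_n meet V and by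
    the left ideal of all a with a e in U_n + V; both become stationary. *)
Lemma dcc_on_addcyc V (e : M) : dcc_on V -> submod V ->
  left_artinian A -> dcc_on (addset V (cyc e)).
Proof.
move=> dV sV dA U sU decU UV.
have dec m n : (m <= n)%N -> U n `<=` U m.
  move=> /subnK<-; elim: (n - m)%N => // k IH x; rewrite addSn => /decU; exact: IH.
have [||n|N1 h1] := dV (fun n => U n `&` V).
- by move=> n; apply: submodI.
- by move=> n x [/decU ? ?].
- by move=> x [].
pose I n : set A := [set a | addset (U n) V (a *: e)].
have [||N2 h2] := dA I.
- move=> n; have sUV := submod_addset (sU n) sV; split=> /=.
  + by rewrite /I /= scale0r; apply: submod0.
  + by move=> a b ha hb; rewrite /I /= scalerDl; apply: submodD.
  + by move=> a b hb; rewrite /I /= -scalerA; apply: submodZ.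
- by move=> n a [u [v [/decU hu hv euv]]]; exists u, v.
exists (maxn N1 N2) => n; rewrite geq_max => /andP[l1 l2].
set N := maxn N1 N2.
have lNn : (N <= n)%N by rewrite geq_max l1.
apply/seteqP; split; first exact: dec.
move=> x UNx; have [v [_ [Vv [a ->] ex]]] := UV _ _ UNx.
have : I N2 a.
  exists x, (- v); split; [|exact: submodN|by rewrite ex addrC addKr].
  exact: (dec _ _ (leq_maxr _ _) _ UNx).
rewrite -(h2 _ l2) => -[u [w [Unu Vw ew]]].
have : (U N1 `&` V) (x - u).
  split; first by apply: (submodB (sU _)); [apply: (dec _ _ (leq_maxl _ _) _ UNx)|apply: (dec _ _ l1)].
  by rewrite ex ew [u + w]addrC addrA addrK; apply: submodD.
rewrite -(h1 _ l1) => -[Unxu _].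
by rewrite -(subrK u x); apply: submodD.
Qed.

End Dcc.

Lemma fin_gen_dcc (A : pzRingType) (M : lmodType A) :
  left_artinian A -> fin_gen M -> dcc M.
Proof.
move=> aA /fin_genP[n [e he]].
suff h : dcc_on (span e n) by move=> U sU dU; apply: h => // i; rewrite -he.
elim: n {he} => [|n IH]; last first.
  by rewrite spanS; apply: dcc_on_addcyc => //; apply: submod_span.
rewrite span0 => U sU _ U0; exists 0%N => m _.
have e0 i : U i = [set 0].
  by apply/seteqP; split=> [|x ->]; [exact: U0|exact: submod0].
by rewrite !e0.
Qed.

(** * The radical of a left artinian ring *)

(** All uses of Zorn's lemma go through this form.  Avoiding 1 gives maximal
    left ideals, avoiding a single element gives maximal proper submodules, and
    avoiding the elements of U outside P gives complements of U modulo P. *)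
Lemma zorn_avoid (A : pzRingType) (M : lmodType A) (F D : set M) :
  submod F -> (forall x, F x -> ~ D x) ->
  exists W, [/\ submod W, F `<=` W, forall x, W x -> ~ D x &
    forall V, submod V -> W `<=` V -> (forall x, V x -> ~ D x) -> V `<=` W].
Proof.
move=> sF FD.
(* Zorn's lemma is applied to the sets X together with F, since the union of the empty chain is empty. *)
pose P (X : set M) := submod (F `|` X) /\ forall x, (F `|` X) x -> ~ D x.
have [|W [[sW WD] maxW]] := @Zorn_bigcup _ P.
  move=> C CP tot; have [[X0 CX0]|C0] := pselect (exists X, C X); last first.
    have -> : \bigcup_(X in C) X = set0.
      by apply/seteqP; split=> // x [X CX]; case: C0; exists X.
    by rewrite /P setU0.
  have memU x : (F `|` \bigcup_(X in C) X) x -> exists2 X, C X & (F `|` X) x.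
    by case=> [Fx|[X CX Xx]]; [exists X0 => //; left|exists X => //; right].
  have sub X : C X -> F `|` X `<=` F `|` \bigcup_(X in C) X.
    by move=> CX x [Fx|Xx]; [left|right; exists X].
  split; last by move=> x /memU[X /CP[_ h] /h].
  split; first by left; apply: submod0.
    move=> x y /memU[X CX hx] /memU[Y CY hy].
    have [/(@setUS _ F) XY|/(@setUS _ F) YX] := tot _ _ CX CY.
      by apply: (sub Y) => //; apply: (submodD (CP _ CY).1) => //; apply: XY.
    by apply: (sub X) => //; apply: (submodD (CP _ CX).1) => //; apply: YX.
  move=> a x /memU[X CX hx]; apply: (sub X) => //.
  exact: (submodZ a (CP _ CX).1).
exists (F `|` W); split=> //.
move=> V sV WV VD; apply: contrapT => VW.
apply: (maxW V); last first.
  suff e : F `|` V = V by rewrite /P e.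
  by apply/seteqP; split=> x; [case=> // Fx; apply: WV; left|right].
split=> [x Wx|h]; first by apply: WV; right.
by apply: VW => x /h; right.
Qed.

Section Radical.
Context (A : pzRingType).
Notation J := (@jacobson_radical A).
Implicit Types (I K L m : set A).

Lemma left_ideal_full I : left_ideal I -> I 1 -> I = setT.
Proof.
case=> _ _ hI I1; apply/seteqP; split=> // a _.
by rewrite -[a]mulr1; apply: hI.
Qed.

Lemma exists_maximal I : left_ideal I -> ~ I 1 ->
  exists2 m, maximal_left_ideal m & I `<=` m.
Proof.
move=> hI I1; have [x Ix e|m [hm Im m1 mm]] := @zorn_avoid A A^o I [set 1] hI.
  by apply: I1; rewrite -e.
have m1' : ~ m 1 by move=> /m1; apply.
exists m => //; split=> // [e|L hL mL]; first by apply: m1'; rewrite e.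
have [/(left_ideal_full hL) ->|L1] := pselect (L 1); first by right.
left; apply/seteqP; split=> //; apply: mm => // x Lx e; apply: L1.
by rewrite -e.
Qed.

Lemma maximal_n1 m : maximal_left_ideal m -> ~ m 1.
Proof. by case=> hm mT _ /(left_ideal_full hm). Qed.

Lemma jac_left_ideal : left_ideal J.
Proof.
split=> [m [[]]//|x y hx hy m hm|a x hx m hm]; have [sm _ _] := hm.
- by apply: (submodD (M := A^o) sm); [apply: hx|apply: hy].
- by apply: (submodZ (M := A^o) a sm); apply: hx.
Qed.

Lemma jac_unit y : J y -> exists c, c * (1 - y) = 1.
Proof.
move=> Jy; apply: contrapT => h.
have [m hm Im] : exists2 m, maximal_left_ideal m & @cyc A A^o (1 - y) `<=` m.
  apply: exists_maximal; first exact: submod_cyc.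
  by move=> [c e]; apply: h; exists c.
apply: (maximal_n1 hm); have [sm _ _] := hm.
rewrite -(subrK y 1); apply: (submodD (M := A^o) sm); last exact: Jy.
by apply/Im/(@cyc_id A A^o).
Qed.

(** Together with [jac_unit] this characterises the radical without maximal
    ideals, which is what shows that it is a two-sided ideal. *)
Lemma jacP x : (forall a, exists c, c * (1 - a * x) = 1) -> J x.
Proof.
move=> h m hm; apply: contrapT => mx; have [sm mT mm] := hm.
have sI : left_ideal (addset (M := A^o) m (cyc (M := A^o) x)).
  by apply: submod_addset => //; apply: submod_cyc.
case: (mm _ sI) => [y my|e|e].
- exact: (addsetl (submod_cyc (M := A^o) x)).
- by apply: mx; rewrite -e; apply: (addsetr (M := A^o) sm); apply: (@cyc_id A A^o).
- have : [set: A] 1 by [].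
  rewrite -e => -[i [_ [mi [a ->] e1]]]; have [c hc] := h a.
  apply: (maximal_n1 hm); rewrite -hc; apply: (submodZ (M := A^o) c sm).
  by rewrite e1 addrK.
Qed.

Lemma jac_mulr x b : J x -> J (x * b).
Proof.
move=> Jx; apply: jacP => a.
have [c hc] := jac_unit (submodZ (M := A^o) (b * a) jac_left_ideal Jx).
have {}hc : c * (1 - b * a * x) = 1 := hc.
(* If c inverts 1 - b a x on the left, then 1 + a x c b inverts 1 - a x b. *)
exists (1 + a * x * c * b); rewrite mulrDl mul1r.
have -> : a * x * c * b * (1 - a * (x * b)) = a * x * (c * (1 - b * a * x)) * b.
  by rewrite !(mulrBr, mulrBl) !mulr1 !mulrA.
by rewrite hc mulr1 mulrA subrK.
Qed.


(** The submodule K N is defined as an intersection, so that an inclusion K N <= P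
    has to be proved on products only. *)
Definition lmulset (K : set A) (M : lmodType A) (N : set M) : set M :=
  [set x | forall P, submod P -> (forall a y, K a -> N y -> P (a *: y)) -> P x].

Lemma submod_lmulset K (M : lmodType A) (N : set M) : submod (lmulset K N).
Proof.
split=> [P sP _|x y hx hy P sP h|a x hx P sP h]; first exact: submod0.
- by apply: submodD => //; [apply: hx|apply: hy].
- by apply: submodZ => //; apply: hx.
Qed.

Lemma lmulset_in K (M : lmodType A) (N : set M) a y : K a -> N y -> lmulset K N (a *: y).
Proof. by move=> Ka Ny P _; apply. Qed.

Lemma lmulset_sub K (M : lmodType A) (N P : set M) : submod P ->
  (forall a y, K a -> N y -> P (a *: y)) -> lmulset K N `<=` P.
Proof. by move=> sP h x; apply. Qed.

Lemma lmulset_subr K (M : lmodType A) (N : set M) : submod N -> lmulset K N `<=` N.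
Proof. by move=> sN; apply: lmulset_sub => // a y _; apply: submodZ. Qed.

(** The radical of a left artinian ring is nilpotent, so J N = N forces N = 0.
    Directly: among the two-sided ideals K inside J with K N = N take a minimal
    one; it is idempotent.  If N were not zero, take L minimal among submodules
    with K L nonzero and x in L with K x nonzero; then K x = L contains x, say
    x = a x with a in J, and 1 - a is left invertible. *)
Lemma nakayama (M : lmodType A) (N : set M) : left_artinian A -> dcc M -> submod N ->
  N `<=` lmulset J N -> N `<=` [set 0].
Proof.
move=> aA dM sN NJN.
have [|K [sK [Kr KJ NK] minK]] := @dcc_min A A^o aA (fun K : set A =>
    [/\ forall a b, K a -> K (a * b), K `<=` J & N `<=` lmulset K N]).
  by exists J; split; [apply: jac_left_ideal|split=> // *; apply: jac_mulr].
(* K is idempotent: K K is a smaller two-sided ideal with (K K) N = K (K N) = N. *)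
have KKK : K `<=` @lmulset K A^o K.
  have sKK := submod_lmulset K (M := A^o) K.
  have KKle := lmulset_subr (K := K) (M := A^o) sK.
  apply: minK => //; split.
  - move=> a b; move: a; apply: (lmulset_sub (M := A^o)).
      split=> [|x y hx hy|a x hx] /=.
      + by rewrite mul0r; apply: (submod0 sKK).
      + by rewrite mulrDl; apply: (submodD sKK).
      + by rewrite -mulrA; apply: (submodZ a sKK).
    move=> a y Ka Ky /=; rewrite -mulrA.
    by apply: (lmulset_in (M := A^o)) => //; apply: Kr.
  - by move=> x /KKle /KJ.
  - move=> x /NK; move: x; apply: lmulset_sub; first exact: submod_lmulset.
    move=> k n Kk /NK hn; move: n hn k Kk.
    apply: lmulset_sub => [|k' n Kk' Nn k Kk]; last first.
      by rewrite scalerA; apply: lmulset_in => //; apply: (lmulset_in (M := A^o)).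
    have s1 := submod_lmulset (@lmulset K A^o K) N.
    split=> [k _|x y hx hy k Kk|a x hx k Kk].
    + by rewrite scaler0; apply: submod0.
    + by rewrite scalerDr; exact: (submodD s1 (hx _ Kk) (hy _ Kk)).
    + by rewrite scalerA; exact: (hx _ (Kr _ _ Kk)).
apply: contrapT => N0.
have [L [sL [x [k [Lx Kk kx0]]] minL]] : exists L : set M,
    [/\ submod L, exists (x : M) (k : A), [/\ L x, K k & k *: x <> 0]
      & forall V, submod V -> (exists (x : M) (k : A), [/\ V x, K k & k *: x <> 0]) ->
        V `<=` L -> L `<=` V].
  apply: dcc_min => //; exists N; split=> //; apply: contrapT => h; apply: N0.
  move=> x /NK; apply: lmulset_sub; first exact: submod_zero.
  by move=> k y Kk Ny; apply: contrapT => ky; apply: h; exists y, k.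
have sKx : submod [set y | exists2 a : A, K a & y = a *: x].
  split; first by exists 0; [apply: (submod0 sK)|rewrite scale0r].
  - move=> _ _ [a Ka ->] [b Kb ->]; exists (a + b); last by rewrite scalerDl.
    exact: (submodD sK).
  - move=> a _ [b Kb ->]; exists (a * b); last by rewrite scalerA.
    exact: (submodZ a sK).
have [||a Ka ax] := minL _ sKx _ _ x Lx.
- apply: contrapT => h; apply: kx0.
  have : @lmulset K A^o K k by apply: KKK.
  apply: (@lmulset_sub K A^o K [set a | a *: x = 0]).
    split=> [|a b ha hb|a b hb]; rewrite /= ?scale0r //.
      by rewrite scalerDl ha hb addr0.
    by rewrite -scalerA hb scaler0.
  move=> a b Ka Kb /=; rewrite -scalerA; apply: contrapT => abx.
  by apply: h; exists ((b : A) *: x), a; split=> //; exists b.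
- by move=> _ [a _ ->]; apply: submodZ.
have [c hc] := jac_unit (KJ _ Ka).
apply: kx0; rewrite -[x]scale1r -hc -scalerA scalerBl scale1r -ax subrr.
by rewrite !scaler0.
Qed.

(** The simple submodules L / J of the left A-module A / J are not contained in
    any proper left ideal I.  With m a maximal left ideal above I, a minimal L
    not inside m does it: a proper L' between J and L lies in m, and if it were
    larger than J, some maximal left ideal m' would not contain it, which
    contradicts the minimality of L compared with L meet m'. *)
Lemma minimal_over_jac I : left_artinian A -> left_ideal I -> ~ I 1 ->
  exists L, [/\ left_ideal L, J `<=` L, ~ L `<=` I &
    forall L', left_ideal L' -> J `<=` L' -> L' `<=` L -> L' `<=` J \/ L `<=` L'].
Proof.
move=> aA sI I1; have [m hm Im] := exists_maximal sI I1.
have [sm mT mm] := hm.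
have [|L [sL [JL Lm] minL]] := @dcc_min A A^o aA (fun L : set A => J `<=` L /\ ~ L `<=` m).
  exists setT; split=> //; split=> // h; exact/(maximal_n1 hm)/h.
exists L; split=> // [LI|L' sL' JL' L'L]; first by apply: Lm => x /LI /Im.
have [LL'|LL'] := pselect (L `<=` L'); [by right|left].
have L'm : L' `<=` m.
  by apply: contrapT => h; apply: LL'; apply: minL.
move=> x L'x; apply: contrapT => Jx.
have [m' hm' m'x] : exists2 m', maximal_left_ideal m' & ~ m' x.
  apply: contrapT => h; apply: Jx => m' hm'; apply: contrapT => m'x.
  by apply: h; exists m'.
have [sm' m'T mm'] := hm'.
have LIm : L `&` m' `<=` m.
  apply: contrapT => h; apply: m'x.
  have : L `<=` L `&` m'.
    apply: minL; [exact: (submodI (M := A^o))|split=> // y Jy; split; [exact: JL|exact: Jy]|].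
    by move=> y [].
  by move=> /(_ x (L'L _ L'x)) [].
apply: Lm => y Ly.
have sS : left_ideal (addset (M := A^o) m' (cyc (M := A^o) x)).
  by apply: submod_addset => //; apply: submod_cyc.
have : addset (M := A^o) m' (cyc (M := A^o) x) y.
  case: (mm' _ sS) => [z|e|->//]; first exact: (addsetl (submod_cyc (M := A^o) x)).
  case: m'x; rewrite -e; apply: (addsetr (M := A^o) sm').
  exact: (@cyc_id A A^o).
case=> m1 [_ [m'm1 [a ->] ey]].
have L'ax : L' (a * x) by apply: (submodZ (M := A^o) a sL').
rewrite ey; apply: (submodD (M := A^o) sm); last exact: L'm.
apply: LIm; split=> //.
have -> : m1 = y - a * x by rewrite ey addrK.
by apply: (submodB (M := A^o) sL) => //; apply: L'L.
Qed.

(** Modules killed by J are semisimple: the submodule U / P of N / P has a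
    complement.  The maximal W with W meet U inside P works, because an x in N
    outside W + U would give a simple module L x, with L as in
    [minimal_over_jac], that could be added to W. *)
Lemma radical_complement (M : lmodType A) (P U N : set M) : left_artinian A ->
  submod P -> submod U -> submod N -> P `<=` N -> U `<=` N ->
  (forall a x, J a -> N x -> P (a *: x)) ->
  exists W, [/\ submod W, P `<=` W, W `<=` N, W `&` U `<=` P & N `<=` addset W U].
Proof.
move=> aA sP sU sN PN UN JN.
have [x Px|W [sW PW WD maxW]] := @zorn_avoid A M P [set y | N y -> U y /\ ~ P y] sP.
  by move=> /(_ (PN _ Px))[].
have WN : W `<=` N by move=> x /WD h; apply: contrapT => Nx; apply: h => /Nx.
have WU : W `&` U `<=` P.
  by move=> x [/WD h Ux]; apply: contrapT => Px; apply: h.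
exists W; split=> // x Nx; apply: contrapT => WUx.
have sWU := submod_addset sW sU.
have [||L [sL JL LI minL]] := @minimal_over_jac [set a | addset W U (a *: x)] aA.
- split=> [|a b ha hb|a b hb]; rewrite /= ?scale0r.
  + exact: submod0.
  + by rewrite scalerDl; apply: submodD.
  + by rewrite -scalerA; apply: submodZ.
- by rewrite /= scale1r.
have sLx : submod [set y | exists2 a : A, L a & y = a *: x].
  split; first by exists 0; [apply: (submod0 (M := A^o) sL)|rewrite scale0r].
  - move=> _ _ [a Ka ->] [b Kb ->]; exists (a + b); last by rewrite scalerDl.
    exact: (submodD (M := A^o) sL).
  - move=> a _ [b Kb ->]; exists (a * b); last by rewrite scalerA.
    exact: (submodZ (M := A^o) a sL).
apply: (LI) => l Ll; apply: (addsetl sU).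
apply: (maxW (addset W [set y | exists2 a : A, L a & y = a *: x])).
- exact: submod_addset.
- exact: addsetl.
- move=> _ [w [_ [Ww [a La ->] ->]]] h.
  have Nax : N (a *: x) by apply: submodZ.
  have [Uy Py] := h (submodD sN (WN _ Ww) Nax); apply: Py; apply: WU; split=> //.
  apply: submodD => //; apply: (PW).
  have [| | |L'J|LL'] := minL (L `&` [set a | addset W U (a *: x)]).
  + apply: (submodI (M := A^o)) => //; split=> [|b c hb hc|b c hc]; rewrite /= ?scale0r.
    * exact: submod0.
    * by rewrite scalerDl; apply: submodD.
    * by rewrite -scalerA; apply: submodZ.
  + move=> b Jb; split; first exact: JL.
    by apply: (addsetl sU); apply: PW; apply: JN.
  + by move=> b [].
  + apply: JN => //; apply: L'J; split=> //.
    exists (- w), (w + a *: x); split=> //; first exact: submodN.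
    by rewrite addKr.
  + by case: LI => b /LL'[].
- by apply: (addsetr sW); exists l.
Qed.

End Radical.

(** * The Hopkins-Levitzki theorem and finite length *)

Section Hopkins.
Context (A : pzRingType).
Notation J := (@jacobson_radical A).

Lemma fgset_addcyc (M : lmodType A) (F : set M) x :
  fgset F -> fgset (addset F (cyc x)).
Proof.
case=> n [e ->]; exists n.+1, (fun i => if i == n then x else e i).
rewrite spanS eqxx; congr (addset _ _); apply/seteqP; split=> y [c ->]; exists c;
  by apply: eq_bigr => i _; rewrite ltn_eqF.
Qed.

(** Take N minimal with V = F + N for some finitely generated F.  If N were not
    J N, a complement modulo J N of a cyclic submodule would be a smaller choice
    of N; so N = J N and N = 0. *)
Lemma hopkins_levitzki (M : lmodType A) (V : set M) : left_artinian A -> dcc M -> submod V -> fgset V.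
Proof.
move=> aA dM sV.
have [|N [sN [NV [F [gF FV VFN]]] minN]] := dcc_min dM (P := fun N =>
    N `<=` V /\ exists F, [/\ fgset F, F `<=` V & V `<=` addset F N]).
  exists V; split=> //; split=> //; exists [set 0]; split.
  - by exists 0%N, (fun=> 0); rewrite span0.
  - by move=> x ->; apply: submod0.
  - exact: (addsetr (submod_zero M)).
have sF : submod F by case: gF => n [e ->]; apply: submod_span.
have N0 : N `<=` [set 0].
  apply: (nakayama aA) => // x Nx; apply: contrapT => Jx.
  have sJN := submod_lmulset J N.
  have sx := submod_cyc x.
  have [|||W [sW JW WN WU NW]] := radical_complement aA sJN (submod_addset sJN sx) sN.
  - exact: lmulset_subr.
  - by apply: addset_sub => //; [apply: lmulset_subr|apply: cyc_sub].
  - by move=> a y Ja Ny; apply: lmulset_in.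
  have Fx : submod (addset F (cyc x)) by apply: submod_addset.
  have NWsub : N `<=` W.
    apply: minN => //; split=> [y /WN /NV //|]; exists (addset F (cyc x)); split.
    - exact: fgset_addcyc.
    - by apply: addset_sub => //; apply: cyc_sub => //; apply: NV.
    - move=> y /VFN[f [m [Ff /NW[w [_ [Ww [j [c [Jj cx ->]] ->]] ->]]]]].
      exists (f + c), (w + j); split; last by rewrite [j + c]addrC addrA addrACA addrA.
        by exists f, c.
      by apply: submodD => //; apply: JW.
  apply: Jx; apply: WU; split; first exact: NWsub.
  by apply: (addsetr sJN); apply: cyc_id.
suff -> : V = F by [].
apply/seteqP; split=> // x /VFN[f [m [Ff /N0 -> ->]]].
by rewrite addr0.
Qed.

(** A chain is recorded by its length and its last term only, so that bounds on
    lengths can be proved by induction on it. *)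
Inductive schain (M : lmodType A) : nat -> set M -> Prop :=
| schain0 U : submod U -> schain 0 U
| schainS n U V : schain n U -> submod V -> U `<=` V ->
    (exists x, V x /\ ~ U x) -> schain n.+1 V.

Definition finlen (M : lmodType A) (V : set M) :=
  exists n, forall k U, schain k U -> U `<=` V -> (k <= n)%N.

Lemma schain_submod (M : lmodType A) k (U : set M) : schain k U -> submod U.
Proof. by case. Qed.

(** If V is maximal in W, intersecting with V a chain inside W loses at most one
    step: the step at which the chain leaves V. *)
Lemma schain_max (M : lmodType A) (V W : set M) k (U : set M) :
  submod V -> submod W -> V `<=` W ->
  (forall V', submod V' -> V' `<=` W -> V `<=` V' -> ~ V' `<=` V -> W `<=` V') ->
  schain k U -> U `<=` W ->
  exists a, schain a (U `&` V) /\ (k <= a + ~~ `[< U `<=` V >])%N.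
Proof.
move=> sV sW VW maxV; elim=> {k U} [U sU _|k U U' cU IH sU' UU' [y [U'y Uy]] U'W].
  by exists 0%N; split=> //; constructor; apply: submodI.
have sU := schain_submod cU.
have [|a [ca ka]] := IH; first by move=> z /UU' /U'W.
have [UV|UV] := pselect (U' `&` V `<=` U).
  have e : U' `&` V = U `&` V.
    by apply/seteqP; split=> z [? ?]; split=> //; [apply: UV|apply: UU'].
  have Vy : ~ V y by move=> Vy; apply: Uy; apply: UV.
  exists a; rewrite e; split=> //.
  have -> : `[< U' `<=` V >] = false by apply/asboolP => /(_ y U'y).
  suff h : U `<=` V by move: ka; rewrite (asboolT h) /= addn0 addn1.
  apply: contrapT => nUV; apply: Uy.
  have [||||z [v [Uz Vv ey]]] := maxV (addset U V) _ _ _ _ y (U'W _ U'y).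
  - exact: submod_addset.
  - by apply: addset_sub => // t /UU' /U'W.
  - exact: addsetr.
  - by move=> h; apply: nUV => z Uz; apply: h; apply: (addsetl sV).
  rewrite ey; apply: submodD => //; apply: UV; split=> //.
  have -> : v = y - z by rewrite ey addrC addKr.
  by apply: submodB => //; apply: UU'.
exists a.+1; split.
  apply: (schainS ca); [exact: submodI|by move=> z [/UU']|].
  apply: contrapT => h; apply: UV => z [U'z Vz]; apply: contrapT => Uz.
  by apply: h; exists z; split=> //; case.
rewrite addSn ltnS; apply: leq_trans ka _; rewrite leq_add2l.
case: (asboolP (U' `<=` V)) => //= h; last by rewrite leq_b1.
by rewrite asboolT // => z /UU' /h.
Qed.

(** A minimal submodule of infinite length is nonzero and finitely generated, so
    it has a maximal proper submodule; that one has finite length, and one more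
    step is allowed by [schain_max]. *)
Lemma finlen_of_dcc (M : lmodType A) : left_artinian A -> dcc M -> finlen [set: M].
Proof.
move=> aA dM; apply: contrapT => nf.
have [|V [sV nV minV]] := dcc_min dM (P := fun V => ~ finlen V).
  by exists setT.
have [n [e eV]] := hopkins_levitzki aA dM sV.
have [V0|[m [em Vm]]] : V = [set 0] \/
    exists m, V = span e m.+1 /\ ~ V `<=` span e m.
  elim: n eV => [|n IH eV]; first by rewrite span0; left.
  have [h|h] := pselect (V `<=` span e n); last by right; exists n.
  apply: IH; apply/seteqP; split=> //; rewrite eV spanS.
  exact/addsetl/submod_cyc.
  apply: nV; rewrite V0; exists 0%N => k U [//|{k U}k U U' cU sU' _ [x [Ux nUx]] U0].
  by case: nUx; rewrite (U0 _ Ux); apply: submod0; apply: schain_submod cU.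
set x := e m; have sF := submod_span e m.
have Fx : ~ span e m x.
  by move=> h; apply: Vm; rewrite em spanS; apply: addset_sub => //; apply: cyc_sub.
have [y Fy yx|W [sW FW Wx maxW]] := zorn_avoid (D := [set x]) sF.
  by apply: Fx; rewrite -yx.
have {}Wx : ~ W x by move=> /Wx; apply.
have FV : span e m `<=` V by rewrite em spanS; apply/addsetl/submod_cyc.
have Vx : V x by rewrite em; apply: span_in.
have sWV := submodI sW sV.
have [b hb] : finlen (W `&` V).
  apply: contrapT => h; apply: Wx.
  have sub : W `&` V `<=` V by move=> y [].
  by have [] := minV _ sWV h sub x Vx.
apply: nV; exists b.+1 => k U cU UV.
have [|V' sV' V'V V1V' V'n|a [ca ka]] := schain_max sWV sV _ _ cU UV.
- by move=> y [].
- suff V'x : V' x.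
    by rewrite em spanS; apply: addset_sub => //; [move=> y Fy; apply: V1V'; split; [apply: FW|apply: FV]|apply: cyc_sub].
  have : addset W V' x.
    apply: contrapT => h; apply: V'n => y V'y; split; last exact: V'V.
    apply: (maxW (addset W V')); first exact: submod_addset.
    - exact: addsetl.
    - by move=> z hz zx; apply: h; rewrite -zx.
    - exact: (addsetr sW).
  case=> w [v [Ww V'v ex]]; rewrite ex; apply: submodD => //; apply: V1V'; split=> //.
  have -> : w = x - v by rewrite ex addrK.
  by apply: submodB => //; apply: V'V.
apply: leq_trans ka _; rewrite -addn1 leq_add ?leq_b1 //.
by apply: (hb _ _ ca) => y [].
Qed.

End Hopkins.

(** * Finitely generated modules and summands of powers *)

Section FinGen.
Context (A : pzRingType).

Lemma fin_gen_fin (M : lmodType A) (I : finType) (e : I -> M) :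
  (forall x, exists c : I -> A, x = \sum_i c i *: e i) -> fin_gen M.
Proof.
move=> he; exists #|I|, (fun i => e (enum_val i)) => x; have [c ->] := he x.
exists (fun i => c (enum_val i)).
by rewrite (reindex (@enum_val I I)) //; apply/onW_bij/enum_val_bij.
Qed.

Lemma fin_gen_surj (M Q : lmodType A) (p : {linear M -> Q}) :
  (forall z, exists y, p y = z) -> fin_gen M -> fin_gen Q.
Proof.
move=> ps [n [e he]]; exists n, (fun i => p (e i)) => z.
have [y <-] := ps z; have [c ->] := he y; exists c.
by rewrite linear_sum; apply: eq_bigr => i _; rewrite linearZ.
Qed.

Lemma fin_gen_inj (K M : lmodType A) (i : {linear K -> M}) :
  injective i -> left_artinian A -> fin_gen M -> fin_gen K.
Proof.
move=> ii aA gM.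
have sR : submod [set x | exists y, i y = x].
  split; first by exists 0; rewrite linear0.
  - by move=> _ _ [x <-] [y <-]; exists (x + y); rewrite linearD.
  - by move=> a _ [x <-]; exists (a *: x); rewrite linearZ.
have [n [e eR]] := hopkins_levitzki aA (fin_gen_dcc aA gM) sR.
have /choice[k hk] : forall j : 'I_n, exists y, i y = e j.
  by move=> j; have := span_in e (ltn_ord j); rewrite -eR.
exists n, k => x; have [c ex] : span e n (i x) by rewrite -eR; exists x.
 exists (fun j => c j); apply: ii; rewrite ex linear_sum.
by apply: eq_bigr => j _; rewrite linearZ hk.
Qed.

Lemma fin_gen_sub (M : lmodType A) (U : smod M) :
  left_artinian A -> fin_gen M -> fin_gen (sub U).
Proof. exact: fin_gen_inj (@subval_inj _ _ _). Qed.

Lemma fin_gen_quo (M : lmodType A) (U : smod M) : fin_gen M -> fin_gen (quo U).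
Proof. exact: fin_gen_surj (@qpi_surj _ _ _). Qed.

End FinGen.

Section AddMod.
Context (A : pzRingType).
Implicit Types S T M N : lmodType A.

(** M is a direct summand of a power of T, stated without choosing that power:
    the identity of M factors through it. *)
Definition addm T M := exists k (a : 'I_k -> {linear M -> T})
  (b : 'I_k -> {linear T -> M}), forall x, x = \sum_i b i (a i x).

Lemma addm_fin T M (I : finType) (a : I -> {linear M -> T}) (b : I -> {linear T -> M}) :
  (forall x, x = \sum_i b i (a i x)) -> addm T M.
Proof.
move=> h; exists #|I|, (fun i => a (enum_val i)), (fun i => b (enum_val i)) => x.
by rewrite {1}[x]h (reindex (@enum_val I I)) //; apply/onW_bij/enum_val_bij.
Qed.

Lemma addm_trans S T M : addm S T -> addm T M -> addm S M.
Proof.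
move=> [k [a [b h]]] [l [c [d h']]].
apply: (@addm_fin _ _ ('I_l * 'I_k)%type (fun p => a p.2 \o c p.1)
  (fun p => d p.1 \o b p.2)) => x.
rewrite -(pair_bigA _ (fun i j => (d i \o b j) ((a j \o c i) x))) {1}[x]h'.
by apply: eq_bigr => i _; rewrite {1}[c i x]h linear_sum.
Qed.

Lemma addm_retract T M (i : {linear M -> T}) (p : {linear T -> M}) :
  cancel i p -> addm T M.
Proof. by move=> h; exists 1%N, (fun=> i), (fun=> p) => x; rewrite big_ord1. Qed.

Lemma addm_iso T M N (f : {linear M -> N}) :
  injective f -> (forall z, exists y, f y = z) -> addm T M -> addm T N.
Proof.
move=> fi fs hM; have [g [_ gf]] := inv_bij fi fs.
exact: addm_trans hM (addm_retract gf).
Qed.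

Lemma addm_iso' T M N (f : {linear M -> N}) :
  injective f -> (forall z, exists y, f y = z) -> addm T N -> addm T M.
Proof.
move=> fi fs hM; have [g [fg _]] := inv_bij fi fs.
exact: addm_trans hM (addm_retract fg).
Qed.

Lemma addm_zero T M : (forall x : M, x = 0) -> addm T M.
Proof.
move=> h; exists 0%N, (fun=> \0), (fun=> \0) => x; rewrite big_ord0; apply: h.
Qed.

Fact pinl_linear M N : linear (fun x : M => (x, 0) : (M * N)%type).
Proof. by move=> a u v; congr pair; rewrite /= scaler0 addr0. Qed.
Definition pinl M N : {linear M -> (M * N)%type} := mklin (@pinl_linear M N).
Fact pinr_linear M N : linear (fun x : N => (0, x) : (M * N)%type).
Proof. by move=> a u v; congr pair; rewrite /= scaler0 addr0. Qed.
Definition pinr M N : {linear N -> (M * N)%type} := mklin (@pinr_linear M N).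

Fact prodmap_linear M N M' N' (f : {linear M -> M'}) (g : {linear N -> N'}) :
  linear (fun p : (M * N)%type => (f p.1, g p.2) : (M' * N')%type).
Proof. by move=> a u v; congr pair; rewrite /= linearP. Qed.
Definition prodmap M N M' N' f g : {linear (M * N)%type -> (M' * N')%type} :=
  mklin (@prodmap_linear M N M' N' f g).

Fact pairmap_linear M N N' (f : {linear M -> N}) (g : {linear M -> N'}) :
  linear (fun x => (f x, g x) : (N * N')%type).
Proof. by move=> a u v; congr pair; rewrite /= linearP. Qed.
Definition pairmap M N N' f g : {linear M -> (N * N')%type} :=
  mklin (@pairmap_linear M N N' f g).

Lemma pair_split M N (p : M * N) : p = pinl M N p.1 + pinr M N p.2.
Proof. by case: p => x y; congr pair; rewrite /= ?addr0 ?add0r. Qed.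

Lemma addm_pairl S T : addm (S * T)%type S.
Proof. exact: (@addm_retract _ _ (pinl S T) fst). Qed.
Lemma addm_pairr S T : addm (S * T)%type T.
Proof. exact: (@addm_retract _ _ (pinr S T) snd). Qed.

Lemma addm_prod T M N : addm T M -> addm T N -> addm T (M * N)%type.
Proof.
move=> [k [a [b h]]] [l [c [d h']]].
apply: (@addm_fin _ _ ('I_k + 'I_l)%type
  (fun s => match s with inl i => a i \o fst | inr j => c j \o snd end)
  (fun s => match s with inl i => pinl M N \o b i | inr j => pinr M N \o d j end)) => x.
by rewrite big_sumType {1}[x]pair_split {1}[x.1]h {1}[x.2]h' !linear_sum.
Qed.

Lemma addm_fin_gen T M : fin_gen T -> addm T M -> fin_gen M.
Proof.
move=> [n [e he]] [k [a [b h]]].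
apply: (@fin_gen_fin _ _ ('I_k * 'I_n)%type (fun p => b p.1 (e p.2))) => x.
have /choice[c hc] : forall i : 'I_k, exists c : 'I_n -> A, a i x = \sum_j c j *: e j.
  by move=> i; apply: he.
exists (fun p => c p.1 p.2).
rewrite -(pair_bigA _ (fun i j => c i j *: b i (e j))) {1}[x]h.
by apply: eq_bigr => i _; rewrite hc linear_sum; apply: eq_bigr => j _; rewrite linearZ.
Qed.

Section Power.
Context (k : nat) (T : lmodType A).
Local Notation Tk := {ffun 'I_k -> T}.

Fact ffeval_linear (i : 'I_k) : linear (fun f : Tk => f i).
Proof. by move=> a u v; rewrite !ffunE. Qed.
Definition ffeval i : {linear Tk -> T} := mklin (ffeval_linear i).

Fact ffsingle_linear (i : 'I_k) :
  linear (fun x : T => [ffun j => if j == i then x else 0] : Tk).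
Proof.
move=> a u v; apply/ffunP => j; rewrite !ffunE.
by case: ifP => //; rewrite scaler0 addr0.
Qed.
Definition ffsingle i : {linear T -> Tk} := mklin (ffsingle_linear i).

Fact fftuple_linear M (a : 'I_k -> {linear M -> T}) :
  linear (fun x => [ffun j => a j x] : Tk).
Proof. by move=> c u v; apply/ffunP => j; rewrite !ffunE linearP. Qed.
Definition fftuple M a : {linear M -> Tk} := mklin (@fftuple_linear M a).

Fact ffsum_linear M (b : 'I_k -> {linear T -> M}) :
  linear (fun f : Tk => \sum_i b i (f i)).
Proof.
move=> c u v; rewrite scaler_sumr -big_split; apply: eq_bigr => i _.
by rewrite !ffunE linearP.
Qed.
Definition ffsum M b : {linear Tk -> M} := mklin (@ffsum_linear M b).

Lemma ffsingle_sum f : f = \sum_i ffsingle i (ffeval i f).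
Proof.
apply/ffunP => j; rewrite sum_ffunE (bigD1 j) //= big1 ?ffunE ?eqxx ?addr0 //.
by move=> i ij; rewrite ffunE eq_sym (negbTE ij).
Qed.

Lemma addm_ffun : addm T Tk.
Proof. by exists k, ffeval, ffsingle; apply: ffsingle_sum. Qed.
End Power.

Lemma addm_power T M : addm T M -> exists k (i : {linear M -> {ffun 'I_k -> T}})
  (p : {linear {ffun 'I_k -> T} -> M}), cancel i p.
Proof.
move=> [k [a [b h]]]; exists k, (fftuple a), (ffsum b) => x /=.
by rewrite {2}[x]h; apply: eq_bigr => i _; rewrite ffunE.
Qed.

Definition jacS : smod (A^o) := @Smod A A^o _ (jac_left_ideal A).

(** The module M is a quotient of a power of A / J, and by [radical_complement]
    the kernel of that quotient map has a complement. *)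
Lemma addm_semisimple M : left_artinian A -> fin_gen M ->
  (forall a x, @jacobson_radical A a -> a *: x = 0 :> M) -> addm (quo jacS) M.
Proof.
move=> aA [n [e he]] JM.
have /choice[phi hphi] : forall i : 'I_n, exists phi : {linear quo jacS -> M},
    forall a : A, phi (qpi jacS a) = a *: e i.
  move=> i; have hl : linear (fun a : A^o => (a : A) *: e i).
    by move=> a u v; rewrite scalerDl scalerA.
  have [||h hh] := factor_surj (p := @qpi _ _ jacS) (g := mklin hl).
  - exact: qpi_surj.
  - by move=> a /qpi_eq0 Ja; apply: JM.
  - by exists h.
pose N : lmodType A := {ffun 'I_n -> quo jacS}.
pose b : {linear N -> M} := ffsum phi.
have bs z : exists f, b f = z.
  have [c ->] := he z; exists [ffun i => qpi jacS (c i)] => /=.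
  by apply: eq_bigr => i _; rewrite ffunE hphi.
have JN a (f : N) : @jacobson_radical A a -> a *: f = 0.
  move=> Ja; apply/ffunP => i; rewrite !ffunE.
  have [x <-] := qpi_surj (f i); rewrite -linearZ; apply/qpi_eq0.
  exact: jac_mulr.
have [||a f Ja _|W [sW _ _ W0 WN]] := radical_complement aA (submod_zero N) (submod_ker b) (submodT N).
- by [].
- by [].
- by rewrite /set1 /= JN.
pose bW : {linear sub (Smod sW) -> M} := b \o @subval _ _ _.
have [|z|g [_ hg]] := inv_bij (f := bW).
- apply: lin_inj => x bx; apply: subval_inj; rewrite linear0.
  by apply: W0; split; [exact: (sub_in x)|].
- have [f <-] := bs z; have [w [u [Ww bu ->]]] := WN f I.
  by exists (mksub (U := Smod sW) Ww); rewrite [RHS]linearD [b u]bu addr0.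
apply: (addm_trans (addm_ffun n _)).
exact: (@addm_retract _ _ (@subval _ _ _ \o g) b).
Qed.

End AddMod.

(** * Modules over representation-finite algebras *)

Section RepFinite.
Context (A : pzRingType).

Lemma addm_dsum_fin n (F : 'I_n -> mod_cat A) i :
  addm (fgmod_mod (dsum_fin F)) (fgmod_mod (F i)).
Proof.
elim: n F i => [|n IH] F i; first by case: i.
case: (unliftP ord0 i) => [j ->|->] /=.
  exact: (addm_trans (addm_pairr _ _) (IH (fun i => F (lift ord0 i)) j)).
exact: addm_pairl.
Qed.

Lemma zero_subcatP (M : fgmod A) : zero_subcat (M : mod_cat A) <-> forall x : M, x = 0.
Proof.
split=> [[f [g [gf _]]] x|h].
  have e : (g : {linear zero_mod A -> M}) ((f : {linear M -> zero_mod A}) x) = x := gf x.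
  have e0 : (f : {linear M -> zero_mod A}) x = 0 by apply/rowP; case.
  by rewrite -e e0 linear0.
exists (\0 : {linear M -> zero_mod A}), (\0 : {linear zero_mod A -> M}).
by split=> x /=; [rewrite [x]h|apply/rowP; case].
Qed.

(** A minimal submodule that is not a summand of a power of the sum T of all
    indecomposables would be neither indecomposable nor a sum of two smaller
    modules, since those would be summands of powers of T. *)
Lemma rep_finite_addm : left_artinian A -> rep_finite A ->
  exists T : lmodType A, fin_gen T /\ forall M : lmodType A, fin_gen M -> addm T M.
Proof.
move=> aA [n [F hF]]; exists (fgmod_mod (dsum_fin F)); split; first exact: fgmodP.
move=> M gM; set T := fgmod_mod _; apply: contrapT => nM.
pose bad (U : set M) := exists sU : submod U, ~ addm T (sub (Smod sU)).
have [|U [sU [sU' bU] minU]] := dcc_min (fin_gen_dcc aA gM) (P := bad).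
  exists setT; split; first exact: submodT; exists (submodT M) => h; apply: nM.
  apply: (@addm_iso _ _ (sub (Smod (submodT M))) _ (@subval _ _ _)) => //.
    exact: subval_inj.
  by move=> z; exists (mksub (U := Smod (submodT M)) (I : setT z)).
set N := sub (Smod sU') in bU.
have gN : fin_gen N by apply: fin_gen_sub.
have [iN|nN] := pselect (indecomposable (FgMod gN : mod_cat A)).
  have [i [f [g [gf _]]]] := hF _ iN; apply: bU.
  apply: (addm_trans (addm_dsum_fin F i)).
  exact: (@addm_retract _ (fgmod_mod (F i)) N f g gf).
apply: nN; split.
  by move=> /zero_subcatP N0; apply: bU; apply: addm_zero.
move=> X Y [f [g [gf fg]]]; apply: contrapT => nXY; apply: bU.
have nX : ~ forall x : fgmod_mod X, x = 0.
  by move=> h; apply: nXY; left; apply/zero_subcatP.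
have nY : ~ forall x : fgmod_mod Y, x = 0.
  by move=> h; apply: nXY; right; apply/zero_subcatP.
pose XY : lmodType A := (fgmod_mod X * fgmod_mod Y)%type.
pose g' : {linear XY -> N} := g.
have gi : injective g' by apply: (can_inj (g := f)); exact: fg.
suff good (Z Z' : lmodType A) (j : {linear Z -> XY}) (j' : {linear Z' -> XY}) :
    injective j -> (forall x y, j x = j' y -> y = 0) -> ~ (forall x : Z', x = 0) -> addm T Z.
  apply: (@addm_trans _ T XY N _ (@addm_retract _ XY N f g gf)).
  apply: addm_prod.
  - apply: (good _ _ (pinl _ (fgmod_mod Y)) (pinr (fgmod_mod X) _)) => //.
      by move=> x y [].
    by move=> x y [].
  - apply: (good _ _ (pinr (fgmod_mod X) _) (pinl _ (fgmod_mod Y))) => //.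
      by move=> x y [].
    by move=> x y [].
move=> ij dj nZ'.
pose h : {linear Z -> M} := @subval _ _ _ \o g' \o j.
have hi : injective h by move=> x y /subval_inj /gi /ij.
have sV := submod_image h (submodT Z).
have VU : h @` setT `<=` U by move=> _ [z _ <-]; apply: (sub_in (g' (j z))).
have aV : addm T (sub (Smod sV)).
  apply: contrapT => nV; apply: nZ' => z'.
  have Uz := sub_in (g' (j' z')).
  have [|z _ hz] := minU _ sV _ VU _ Uz; first by exists sV.
  by apply: (dj z); apply: gi; apply: subval_inj.
have hh z : sset (Smod sV) (h z) by exists z.
have [k hk] := factor_inj (g := h) (@subval_inj _ _ (Smod sV))
  (fun x => ex_intro _ (mksub (hh x)) erefl).
apply: (addm_iso' (f := k)) aV.
  by move=> x y e; apply: hi; rewrite -!hk e.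
move=> w; have [z _ hz] := sub_in w.
by exists z; apply: subval_inj; rewrite hk.
Qed.
End RepFinite.

(** * Restriction of scalars *)

(** The alias mentions phi so that the A-module structure can be attached to it. *)
Definition resm (A B : pzRingType) (phi : {rmorphism A -> B}) (M : lmodType B) : Type := M.
HB.instance Definition _ (A B : pzRingType) (phi : {rmorphism A -> B}) (M : lmodType B) :=
  GRing.Zmodule.on (resm phi M).

Section Restrict.
Context (A B : pzRingType) (phi : {rmorphism A -> B}).
Local Notation resm := (resm phi).

Section ResLmod.
Context (M : lmodType B).
Definition rscale (a : A) (x : resm M) : resm M := phi a *: (x : M).
Fact rscaleA a b v : rscale a (rscale b v) = rscale (a * b) v.
Proof. by rewrite /rscale scalerA rmorphM. Qed.
Fact rscale1 : left_id 1 rscale.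
Proof. by move=> v; rewrite /rscale rmorph1 scale1r. Qed.
Fact rscaleDr : right_distributive rscale +%R.
Proof. by move=> a u v; rewrite /rscale scalerDr. Qed.
Fact rscaleDl v : {morph rscale^~ v : a b / a + b}.
Proof. by move=> a b; rewrite /rscale rmorphD scalerDl. Qed.
HB.instance Definition _ :=
  GRing.Zmodule_isLmodule.Build A (resm M) rscaleA rscale1 rscaleDr rscaleDl.

Lemma resmE (a : A) (x : resm M) : a *: x = phi a *: (x : M). Proof. by []. Qed.
End ResLmod.

Fact reslin_linear (M N : lmodType B) (f : {linear M -> N}) :
  linear (f : resm M -> resm N).
Proof. by move=> a u v; rewrite !resmE -linearP. Qed.
Definition reslin (M N : lmodType B) (f : {linear M -> N}) :
  {linear resm M -> resm N} := mklin (reslin_linear f).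

Lemma fin_gen_resm (M : lmodType B) : fin_gen (resm (B^o)) -> fin_gen M -> fin_gen (resm M).
Proof.
move=> [n [b hb]] [m [e he]].
apply: (@fin_gen_fin _ _ ('I_m * 'I_n)%type (fun p => (b p.2 : B) *: (e p.1 : M) : resm M)) => x.
have [c ec] := he x.
have /choice[d hd] : forall i : 'I_m, exists d : 'I_n -> A, c i = \sum_j d j *: b j :> resm (B^o).
  by move=> i; apply: hb.
exists (fun p => d p.1 p.2).
rewrite -(pair_bigA _ (fun i j => d i j *: ((b j : B) *: (e i : M) : resm M))) ec.
apply: eq_bigr => i _; rewrite hd scaler_suml; apply: eq_bigr => j _.
by rewrite resmE scalerA.
Qed.

Lemma addm_resm (T M : lmodType B) : addm T M -> addm (resm T) (resm M).
Proof.
by move=> [k [a [b h]]]; exists k, (fun i => reslin (a i)), (fun i => reslin (b i)).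
Qed.

End Restrict.

(** * The radical of a torsionless module over a larger ring *)

Definition torsionless (A : pzRingType) (M : lmodType A) :=
  exists n (i : {linear M -> 'rV[A]_n}), injective i.

Section RadStep.
Context (A B : pzRingType) (phi : {rmorphism A -> B}).
Notation J := (@jacobson_radical A).
Hypothesis phi_inj : injective phi.
Hypothesis phiJ : forall b a, J a -> exists2 a', J a' & phi a' = b * phi a.

Definition jacmul (M : lmodType A) : smod M := Smod (submod_lmulset J [set: M]).

(** The B-module J M: a B-module, torsionless over B, with an A-linear
    identification onto J M.  By [rs_compat] the action of B is the one given by
    the products of B with J, which makes the construction functorial. *)
Record radstep (M : lmodType A) := RadStep {
  rs_mod : lmodType B;
  rs_map : {linear resm phi rs_mod -> M};
  rs_inj : injective rs_map;
  rs_img : forall x, sset (jacmul M) x <-> exists y, rs_map y = x;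
  rs_torsionless : torsionless rs_mod;
  rs_compat : forall b a a' x (y : rs_mod), J a -> J a' -> phi a' = b * phi a ->
    rs_map y = a *: x -> rs_map (b *: y : rs_mod) = a' *: x
}.

(** Embed M into A^n and further into B^n; the image of J M is stable under B,
    as b (a x) = (b a) x for a in J. *)
Lemma radstep_exists (M : lmodType A) : torsionless M -> inhabited (radstep M).
Proof.
move=> [n [i ii]].
pose e (x : M) : 'rV[B]_n := map_mx phi (i x).
have eD x y : e (x + y) = e x + e y by rewrite /e linearD map_mxD.
have eZ a x : e (a *: x) = phi a *: e x by rewrite /e linearZ map_mxZ.
have e0 : e 0 = 0 by rewrite /e linear0 map_mx0.
have ei : injective e.
  move=> x y /matrixP h; apply: ii; apply/matrixP => k l.
  by have := h k l; rewrite !mxE => /phi_inj.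
have sJ := smodP (jacmul M).
have Bact x : sset (jacmul M) x -> forall b, exists2 x', sset (jacmul M) x' & b *: e x = e x'.
  move: x; apply: lmulset_sub.
    split=> [b|x y hx hy b|a x hx b].
    - by exists 0; rewrite ?e0 ?scaler0 //; exact: (submod0 sJ).
    - have [x' ? ex] := hx b; have [y' ? ey] := hy b.
      by exists (x' + y'); [exact: (submodD sJ)|rewrite !eD scalerDr ex ey].
    - have [x' ? ex] := hx (b * phi a).
      by exists x' => //; rewrite eZ scalerA.
  move=> a x Ja _ b; have [a' Ja' ea'] := phiJ b Ja.
  by exists (a' *: x); [apply: lmulset_in|rewrite !eZ scalerA ea'].
have sY : submod [set y | exists2 x, sset (jacmul M) x & e x = y].
  split; first by exists 0 => //; exact: (submod0 sJ).
  - move=> _ _ [x hx <-] [y hy <-]; exists (x + y) => //; exact: (submodD sJ).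
  - by move=> b _ [x hx <-]; have [x' hx' ->] := Bact x hx b; exists x'.
pose Y : lmodType B := sub (Smod sY).
have /choice[k hk] : forall y : Y, exists x, sset (jacmul M) x /\ e x = subval y.
  by move=> y; have [x ? ?] := sub_in y; exists x.
have kl : linear (k : resm phi Y -> M).
  move=> a u v; apply: ei; rewrite eD eZ.
  by rewrite (hk (a *: u + v)).2 (hk u).2 (hk v).2.
have kE (y : Y) x : subval y = e x -> k y = x.
  by move=> h; apply: ei; rewrite (hk y).2.
constructor; apply: (@RadStep M Y (mklin kl)) => /=.
- by move=> u v euv; apply: subval_inj; rewrite -(hk u).2 -(hk v).2 euv.
- move=> x; split=> [hx|[y <-]]; last exact: (hk y).1.
  have hy : sset (Smod sY) (e x) by exists x.
  by exists (mksub hy); apply: kE.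
- by exists n, (@subval _ _ _); apply: subval_inj.
- move=> b a a' x y Ja Ja' ea ey; apply: kE.
  by rewrite linearZ /= -(hk y).2 ey !eZ scalerA ea.
Qed.

(** On products, B-linearity reads h (b (a x)) = (b a) g(x) = b (a g(x)); the
    elements of J M on which it holds form an A-submodule. *)
Lemma radstep_fun (M M' : lmodType A) (g : {linear M -> M'})
    (S : radstep M) (S' : radstep M') :
  {h : {linear rs_mod S -> rs_mod S'} | forall y, rs_map S' (h y) = g (rs_map S y)}.
Proof.
have gJ x : sset (jacmul M) x -> sset (jacmul M') (g x).
  move: x; apply: lmulset_sub; first exact/submod_preimage/smodP.
  by move=> a x Ja _; rewrite /preimage /= linearZ; apply: lmulset_in.
have hex : forall y : rs_mod S, exists z : rs_mod S', rs_map S' z = g (rs_map S y).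
  move=> y; exact: ((rs_img S' _).1 (gJ _ ((rs_img S _).2 (ex_intro _ y erefl)))).
have [h hh] := choice hex.
have hD u v : h (u + v) = h u + h v.
  by apply: (@rs_inj _ S'); rewrite linearD !hh (linearD (rs_map S)) linearD.
have h0 : h 0 = 0 by apply: (@addrI _ (h 0)); rewrite -hD !addr0.
have hZ b y : h (b *: y) = b *: h y.
  have : sset (jacmul M) (rs_map S y) by apply/(rs_img S); exists y.
  suff sub : sset (jacmul M) `<=`
      [set x | exists2 y : rs_mod S, rs_map S y = x & forall b : B, h (b *: y) = b *: h y].
    by move=> /sub[y' /rs_inj-> ].
  apply: lmulset_sub.
    split.
    - by exists 0; rewrite ?linear0 // => c; rewrite scaler0 h0 scaler0.
    - move=> _ _ [u <- hu] [v <- hv]; exists (u + v); first by rewrite linearD.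
      by move=> c; rewrite scalerDr !hD hu hv scalerDr.
    - move=> a _ [u <- hu]; exists (phi a *: u); first by rewrite -linearZ.
      by move=> c; rewrite scalerA !hu scalerA.
  move=> a x Ja _.
  have [y' ey'] : exists y' : rs_mod S, rs_map S y' = a *: x.
    exact: ((rs_img S _).1 (lmulset_in Ja (I : [set: M] x))).
  exists y' => // c; have [a' Ja' ea'] := phiJ c Ja.
  have e1 := rs_compat Ja Ja' ea' ey'.
  have ey2 : rs_map S' (h y') = a *: g x by rewrite hh ey' linearZ.
  apply: (@rs_inj _ S'); rewrite hh (rs_compat Ja Ja' ea' ey2).
  by rewrite -linearZ -e1.
have hl : linear h by move=> b u v; rewrite hD hZ.
by exists (mklin hl).
Qed.
End RadStep.

(** * Filtrations of torsionless modules *)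

Lemma fin_gen_regular (A : pzRingType) : fin_gen (A^o).
Proof.
exists 1%N, (fun=> 1) => x; exists (fun=> x); rewrite big_ord1.
exact: esym (mulr1 x).
Qed.

Section Artin.
Context (R : comNzRingType).

Lemma artin_algebra_left_artinian (A : algType R) : artin_algebra A -> left_artinian A.
Proof.
move=> [aR gA]; have dA : dcc (A : lmodType R) by apply: fin_gen_dcc.
move=> I sI decI; apply: dA => // n; have [I0 ID IM] := sI n.
by split=> // r x Ix; rewrite -mulr_algl; apply: IM.
Qed.

Lemma artin_fin_gen_resm (A B : algType R) (f : {lrmorphism A -> B}) :
  artin_algebra B -> fin_gen (resm (f : {rmorphism A -> B}) (B^o)).
Proof.
move=> [_ [n [e he]]]; exists n, e => x; have [c ->] := he x.
exists (fun i => (c i)%:A); apply: eq_bigr => i _.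
have ef : f (c i)%:A = (c i)%:A by rewrite linearZ /= rmorph1.
by transitivity ((c i)%:A * e i); [rewrite mulr_algl|rewrite -{1}ef].
Qed.

Lemma jac_image_absorbs (A B : algType R) (f : {lrmorphism A -> B}) :
  left_ideal (f @` @jacobson_radical A) ->
  forall b a, @jacobson_radical A a -> exists2 a', @jacobson_radical A a' & f a' = b * f a.
Proof. by case=> _ _ h b a Ja; have [a' ? ?] := h b (f a) (ex_intro2 _ _ a Ja erefl); exists a'. Qed.
End Artin.

Lemma fin_gen_of_resm (A B : pzRingType) (phi : {rmorphism A -> B}) (M : lmodType B) :
  fin_gen (resm phi M) -> fin_gen M.
Proof.
move=> [n [e he]]; exists n, e => x; have [c ->] := he x.
by exists (fun i => phi (c i)).
Qed.

Section Filtration.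
Context (A : pzRingType).
Implicit Types S T M N U W : lmodType A.

(** M has a filtration with n + 1 pieces in add T, each step being an extension
    with a piece as submodule, as in the definition of [ext_gen]. *)
Fixpoint mfilt T n M : Prop :=
  if n is m.+1 then exists U W (f : {linear U -> M}) (g : {linear M -> W}),
    [/\ addm T U, mfilt T m W & short_exact f g]
  else addm T M.

Lemma mfilt_mono S T n M : addm S T -> mfilt T n M -> mfilt S n M.
Proof.
move=> hST; elim: n M => [|n IH] M /=; first exact: addm_trans.
move=> [U [W [f [g [aU hW fg]]]]]; exists U, W, f, g; split=> //.
  exact: addm_trans aU.
exact: IH.
Qed.

(** The radical filtration produces its pieces as quotients, whereas [mfilt]
    peels them off as submodules; a new quotient piece is pushed through the
    filtration by induction. *)
Lemma mfilt_extr T n N' N U (f : {linear N' -> N}) (g : {linear N -> U}) :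
  mfilt T n N' -> addm T U -> short_exact f g -> mfilt T n.+1 N.
Proof.
elim: n N' N f g => [|n IH] N' N f g /=; first by exists N', U, f, g.
move=> [U0 [W [f0 [g0 [aU0 hW [f0i g0s e0]]]]]] aU [fi gs e].
pose V := Smod (submod_image (f \o f0) (submodT U0)).
have [|h hh] := factor_surj (p := g0) (g := @qpi _ _ V \o f) g0s.
  move=> x /e0[u <-]; apply/qpi_eq0; by exists u.
have [||k hk] := factor_surj (p := @qpi _ _ V) (g := g).
- exact: qpi_surj.
- by move=> x /qpi_eq0[u _ <-]; apply/e; exists (f0 u).
exists U0, (quo V), (f \o f0), (@qpi _ _ V); split=> //; last first.
  split; [exact: inj_comp|exact: qpi_surj|].
  by move=> y; rewrite qpi_eq0; split=> [[u _ <-]|[u <-]]; exists u.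
apply: (IH W (quo V) h k hW aU); split.
- apply: lin_inj => w; have [x <-] := g0s w; rewrite hh => /qpi_eq0[u _ /fi <-].
  by apply/e0; exists u.
- by move=> z; have [y <-] := gs z; exists (qpi V y); rewrite hk.
- move=> q; have [y <-] := qpi_surj q; rewrite hk e; split=> [[x <-]|[w]].
    by exists (g0 x); rewrite hh.
  have [x <-] := g0s w; rewrite hh => /qpi_eq[u _ eu].
  exists (x - f0 u); rewrite linearB; move/eqP: eu.
  by rewrite /= eq_sym subr_eq => /eqP->; rewrite addrC addKr.
Qed.

End Filtration.

Lemma mfilt_resm (A B : pzRingType) (phi : {rmorphism A -> B}) (T : lmodType B) n M :
  mfilt T n M -> mfilt (resm phi T) n (resm phi M).
Proof.
elim: n M => [|n IH] M /=; first exact: addm_resm.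
move=> [U [W [f [g [aU hW fg]]]]].
exists (resm phi U), (resm phi W), (reslin phi f), (reslin phi g); split=> //.
  exact: addm_resm.
exact: IH.
Qed.

(** The step from B to A adds the piece M / J M, which is semisimple over A;
    its submodule J M is a torsionless B-module with s + 1 pieces over B. *)
Lemma torsionless_mfilt (R : comNzRingType) (A : algType R) s : artin_algebra A -> lrep_chain A s ->
  exists T : lmodType A, fin_gen T /\ forall M, fin_gen M -> torsionless M -> mfilt T s M.
Proof.
move=> + hc; elim: hc => {A s} [A rA /artin_algebra_left_artinian aA|].
  have [T [gT hT]] := rep_finite_addm aA rA.
  by exists T; split=> // M gM _; apply: hT.
move=> A B f s hB fi _ fJ _ IH hA; have [T [gT hT]] := IH hB.
have aA := artin_algebra_left_artinian hA.
pose phi : {rmorphism A -> B} := f.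
have gB : fin_gen (resm phi (B^o)) by apply: artin_fin_gen_resm.
exists (resm phi T * quo (jacS A))%type; split.
  apply: fin_gen_prod; first exact: fin_gen_resm.
  exact/fin_gen_quo/fin_gen_regular.
move=> M gM tM; have [S] := radstep_exists (phi := phi) fi (jac_image_absorbs fJ) tM.
have gY : fin_gen (rs_mod S).
  apply: (@fin_gen_of_resm _ _ phi); exact: (fin_gen_inj (@rs_inj _ _ _ _ S)).
have hY := mfilt_resm phi (hT _ gY (rs_torsionless S)).
apply: (@mfilt_extr _ _ _ _ _ _ (rs_map S) (@qpi _ _ (jacmul M))).
- exact: mfilt_mono (addm_pairl _ _) hY.
- apply: (addm_trans (addm_pairr _ _)); apply: addm_semisimple => //.
    exact: fin_gen_quo.
  move=> a q Ja; have [x <-] := qpi_surj q; rewrite -linearZ; apply/qpi_eq0.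
  exact: lmulset_in.
- split; [exact: rs_inj|exact: qpi_surj|].
  by move=> y; rewrite qpi_eq0; apply: rs_img.
Qed.

(** * Essential extensions and relatively injective hulls *)

Section Chains.
Context (A : pzRingType).

Lemma schain_mono (M : lmodType A) k (U V : set M) :
  schain k U -> submod V -> U `<=` V -> schain k V.
Proof.
case=> {k U} [U sU|k U' U cU sU U'U [x [Ux U'x]]] sV UV; first by constructor.
apply: (schainS cU) => //; first by move=> y /U'U /UV.
by exists x; split=> //; apply: UV.
Qed.

(** Each strict step of a chain is strict on kernels or on images. *)
Lemma schain_add (M N : lmodType A) (g : {linear M -> N}) k (U : set M) : schain k U ->
  exists a b, [/\ (k <= a + b)%N, schain a (U `&` [set x | g x = 0]) & schain b (g @` U)].
Proof.
have sK := submod_ker g; elim=> {k U} [U sU|k U V cU [a [b [kab ca cb]]] sV UV [x [Vx Ux]]].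
  by exists 0%N, 0%N; split=> //; constructor; [apply: submodI|apply: submod_image].
have sU := schain_submod cU.
have sVK := submodI sV sK.
have UVK : U `&` [set x | g x = 0] `<=` V `&` [set x | g x = 0] by move=> y [/UV].
have sgV := submod_image g sV.
have UVg : g @` U `<=` g @` V by move=> _ [y /UV Vy <-]; exists y.
have [gVU|gVU] := pselect (g @` V `<=` g @` U).
  exists a.+1, b; split; first by rewrite addSn ltnS.
    apply: (schainS ca) => //.
    have [u Uu eu] : (g @` U) (g x) by apply: gVU; exists x.
    exists (x - u); split.
      by split; [apply: submodB => //; apply: UV|rewrite /= linearB eu subrr].
    by case=> h _; apply: Ux; rewrite -(subrK u x); apply: submodD.
  exact: schain_mono UVg.
exists a, b.+1; split; first by rewrite addnS ltnS.
  exact: schain_mono UVK.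
apply: (schainS cb) => //.
apply: contrapT => h; apply: gVU => y gVy; apply: contrapT => gUy.
by apply: h; exists y.
Qed.

Lemma schain_image (M N : lmodType A) (g : {linear M -> N}) k (U : set M) :
  injective g -> schain k U -> schain k (g @` U).
Proof.
move=> gi; elim=> {k U} [U sU|k U V cU IH sV UV [x [Vx Ux]]].
  by constructor; apply: submod_image.
apply: (schainS IH); [exact: submod_image|by move=> _ [y /UV Vy <-]; exists y|].
by exists (g x); split; [exists x|move=> [y Uy /gi e]; apply: Ux; rewrite -e].
Qed.

Lemma schain_preimage (M N : lmodType A) (g : {linear M -> N}) k (U : set N) :
  schain k U -> (forall x, U x -> exists y, g y = x) -> schain k (g @^-1` U).
Proof.
elim=> {k U} [U sU|k U V cU IH sV UV [x [Vx Ux]]] h.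
  by constructor; apply: submod_preimage.
apply: (schainS (IH (fun y Uy => h y (UV y Uy)))).
- exact: submod_preimage.
- by move=> y /UV.
- by have [y e] := h x Vx; exists y; rewrite /preimage /= e.
Qed.
End Chains.

Lemma schain_resm (A B : pzRingType) (phi : {rmorphism A -> B}) (M : lmodType B) k (U : set M) :
  schain k U -> @schain A (resm phi M) k U.
Proof.
have sr (V : set M) : submod V -> @submod A (resm phi M) V.
  by case=> ? ? hZ; split=> // a x; apply: hZ.
elim=> {k U} [U sU|k U V cU IH sV UV h]; first by constructor; apply: sr.
by apply: (schainS IH) => //; apply: sr.
Qed.

(** Injectivity with respect to finitely generated modules only; this is all
    that is needed, and it can be checked without leaving such modules. *)
Definition relinj (A : pzRingType) (E : lmodType A) :=
  forall (X Y : lmodType A) (i : {linear X -> Y}) (h : {linear X -> E}),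
  fin_gen X -> fin_gen Y -> injective i ->
  exists h' : {linear Y -> E}, forall x, h' (i x) = h x.

Section Hull.
Context (R : comNzRingType) (A : algType R) (hA : artin_algebra A).
Context (T : lmodType A) (gT : fin_gen T).
Notation J := (@jacobson_radical A).
Let aA : left_artinian A := artin_algebra_left_artinian hA.
Let rho : {rmorphism R -> A} := in_alg A.
Local Notation resR X := (resm rho X).

Definition essential (X : lmodType A) (j : {linear T -> X}) :=
  injective j /\ forall W : set X, submod W ->
    (forall t, W (j t) -> j t = 0) -> W `<=` [set 0].

(** The elements killed by J form a semisimple module, in which the part inside T
    has a complement; that complement meets T trivially and so vanishes. *)
Lemma essential_socle (X : lmodType A) (j : {linear T -> X}) x : essential j ->
  (forall a, J a -> a *: x = 0) -> exists t, j t = x.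
Proof.
move=> [_ ej] Jx.
pose S : set X := [set x | forall a, J a -> a *: x = 0].
have sS : submod S.
  split=> [a _|u v hu hv a Ja|b u hu a Ja]; rewrite ?scaler0 //.
    by rewrite scalerDr hu // hv // addr0.
  by rewrite scalerA hu //; apply: jac_mulr.
have sU := submodI sS (submod_image j (submodT T)).
have [||a y Ja Sy|W [sW _ WS WU SW]] := radical_complement aA (submod_zero X) sU sS.
- by move=> _ -> a _; rewrite scaler0.
- by move=> y [].
- exact: Sy.
have W0 : W `<=` [set 0].
  by apply: ej => // t Wjt; apply: WU; split=> //; split; [exact: WS|exists t].
by have [w [_ [/W0 -> [_ [t _ <-]] ->]]] := SW x Jx; exists t; rewrite add0r.
Qed.

(** This is Hom_A(A / AK, X); in general it is only an R-submodule of X, which is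
    why lengths are taken over R. *)
Definition ann (K : set A) (X : lmodType A) : set X :=
  [set x | forall a, K a -> a *: x = 0].

Definition ann_bounded (K : set A) := exists n, forall (X : lmodType A) (j : {linear T -> X}),
  essential j -> forall k (U : set (resR X)), schain k U -> U `<=` (@ann K X : set (resR X)) -> (k <= n)%N.

Lemma scale_central (X : lmodType A) (e : A) : linear (fun x : resR X => (e *: (x : X)) : resR X).
Proof.
move=> r u v; rewrite !resmE scalerDr !scalerA; congr (_ + _).
have -> // : e * rho r = rho r * e by rewrite /rho /= mulr_algl mulr_algr.
Qed.

(** Multiplication by e is R-linear on the annihilator of K.  Its kernel is the
    annihilator of K + A e, and its image is killed by J, so it lies in T. *)
Lemma ann_bounded_step (K : set A) e : left_ideal K -> (forall a, J a -> K (a * e)) ->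
  ann_bounded (addset (M := A^o) K (cyc (M := A^o) e)) -> ann_bounded K.
Proof.
move=> sK Je [n hn].
have [aR gR] := hA.
have gTR : fin_gen (resR T).
  apply: fin_gen_resm gT; have [l [b hb]] := gR; exists l, b => x.
  have [c ->] := hb x; exists c; apply: eq_bigr => i _.
  by rewrite -mulr_algl.
have [m hm] := finlen_of_dcc aR (fin_gen_dcc aR gTR).
exists (n + m)%N => X j ej k U cU UK.
have [a [b [kab ca cb]]] := schain_add (mklin (scale_central (X := X) e)) cU.
apply: leq_trans kab _; apply: leq_add.
  apply: (hn _ _ ej _ _ ca) => x [Ux ex] _ [c [_ [Kc [d ->] ->]]].
  by rewrite scalerDl (UK _ Ux) // add0r -[d *: _]/(d * e) -scalerA [e *: x]ex scaler0.
have range y : ([set e *: (x : X) | x in U] : set (resR X)) y -> exists t, reslin rho j t = y.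
  case=> x Ux <-; apply: (essential_socle ej) => d Jd.
  by rewrite scalerA; apply: (UK _ Ux); apply: Je.
by apply: (hm _ _ (schain_preimage cb range)).
Qed.

(** Let I be minimal among the left ideals whose annihilators are bounded.  As I
    is generated over J I by finitely many elements, [ann_bounded_step] also
    bounds the annihilators of J I; so I = J I and I = 0. *)
Lemma ann_bounded0 : ann_bounded [set 0].
Proof.
have [|I [sI bI minI]] := @dcc_min A A^o aA ann_bounded.
  exists setT; split=> //; exists 0%N => X j ej k U [//|{k U}k U V cU sV _ [x [Vx Ux]] hV].
  have x0 : x = 0 by rewrite -[x](scale1r (x : X)); apply: hV.
  by case: Ux; rewrite x0; apply: submod0 (schain_submod cU).
have [n [e eI]] := hopkins_levitzki aA (aA : @dcc A A^o) sI.
have sJI := @submod_lmulset A J A^o I.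
have JI := @lmulset_subr A J A^o I sI.
(* A chain from J I to I in which each ideal adds one generator to the previous one. *)
pose K i := addset (@lmulset A J A^o I) (span e i).
have sK i : @submod A A^o (K i) by apply: submod_addset => //; apply: submod_span.
have bK i : (i <= n)%N -> ann_bounded (K (n - i)%N).
  elim: i => [_|i IH lin].
    rewrite subn0; suff -> : K n = I by [].
    rewrite /K -eI; apply/seteqP; split; first exact: addset_sub.
    exact: addsetr.
  have {IH} := IH (ltnW lin).
  have -> : (n - i)%N = (n - i.+1).+1 by rewrite subnSK.
  have lt : (n - i.+1 < n)%N by rewrite ltn_subrL (leq_ltn_trans _ lin).
  move: (n - i.+1)%N lt => l lt bl.
  apply: (@ann_bounded_step _ (e l)); first exact: (sK l).
    move=> a Ja; apply: (addsetl (submod_span e l)).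
    by apply: (@lmulset_in A J A^o I a (e l)) => //; rewrite eI; apply: span_in.
  suff <- : K l.+1 = addset (M := A^o) (K l) (cyc (e l)) by [].
  rewrite /K spanS; apply/seteqP; split=> x.
    by case=> u [_ [hu [v [w [hv hw ->]]] ->]]; exists (u + v), w; rewrite addrA; split=> //; exists u, v.
  case=> _ [w [[u [v [hu hv ->]]] hw ->]]; exists u, (v + w); rewrite addrA; split=> //.
  by exists v, w.
have {}bK : ann_bounded (@lmulset A J A^o I).
  have := bK n (leqnn n); rewrite subnn; suff -> : K 0%N = @lmulset A J A^o I by [].
  rewrite /K span0; apply/seteqP; split; last exact/addsetl/submod_zero.
  by apply: addset_sub => // _ ->; apply: submod0.
have I0 := nakayama aA (aA : @dcc A A^o) sI (minI _ sJI bK JI).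
suff <- : I = [set 0] by [].
by apply/seteqP; split=> // _ ->; apply: (submod0 sI).
Qed.

(** The zero ideal annihilates everything, so its annihilator is all of X. *)
Lemma essential_bounded : exists n, forall (X : lmodType A) (j : {linear T -> X}),
  essential j -> forall k (U : set X), schain k U -> (k <= n)%N.
Proof.
have [n hn] := ann_bounded0; exists n => X j ej k U cU.
apply: (hn _ _ ej _ _ (schain_resm rho cU)) => x _ _ ->.
by rewrite scale0r.
Qed.

(** Take an essential extension with a chain of submodules as long as possible;
    a proper essential extension of it would have a longer chain. *)
Lemma maximal_essential : exists (E : lmodType A) (j : {linear T -> E}),
  [/\ fin_gen E, essential j & forall (X : lmodType A) (i : {linear E -> X}),
    fin_gen X -> injective i -> essential (i \o j) -> forall x, exists y, i y = x].
Proof.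
have [n hn] := essential_bounded.
pose P k := `[< exists (E : lmodType A) (j : {linear T -> E}),
  [/\ fin_gen E, essential j & schain k [set: E]] >].
have exP : exists k, P k.
  exists 0%N; apply/asboolP; exists T, idfun; split=> //; last by constructor.
  split=> // W sW h t Wt; exact: (h t Wt).
have bP k : P k -> (k <= n)%N.
  by move=> /asboolP[E [j [_ ej cE]]]; apply: hn ej _ _ cE.
case: (ex_maxnP exP bP) => k /asboolP[E [j [gE ej cE]]] maxk.
exists E, j; split=> // X i gX ii eij x; apply: contrapT => hx.
suff : P k.+1 by move=> /maxk; rewrite ltnn.
apply/asboolP; exists X, (i \o j); split=> //.
apply: (schainS (schain_image ii cE)) => //.
by exists x; split=> // -[y _ e]; apply: hx; exists y.
Qed.

(** Let E be a maximal essential extension of T.  A monomorphism E -> Y splits: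
    modulo a submodule W maximal among those that meet E trivially, E becomes
    essential in Y / W, hence all of it.  A map from X to E extends along
    X -> Y because the pushout is an extension of E and so splits. *)
Lemma relinj_hull : exists (E : lmodType A) (j : {linear T -> E}),
  [/\ fin_gen E, injective j & relinj E].
Proof.
have [E [j [gE ej maxE]]] := maximal_essential.
exists E, j; split=> //; first exact: ej.1.
have split_mono (Y : lmodType A) (i : {linear E -> Y}) : fin_gen Y -> injective i ->
    exists r : {linear Y -> E}, forall x, r (i x) = x.
  move=> gY ii.
  have [|W [sW _ WD maxW]] := zorn_avoid (F := [set 0 : Y])
      (D := [set y | y <> 0 /\ exists x, i x = y]) (submod_zero Y).
    by move=> _ -> [].
  pose p : {linear E -> quo (Smod sW)} := @qpi _ _ (Smod sW) \o i.
  have pinj : injective p.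
    apply: lin_inj => x /qpi_eq0 Wix; apply: ii; rewrite linear0.
    by apply: contrapT => ix0; apply: (WD _ Wix); split=> //; exists x.
  have ep : essential (p \o j).
    split; first exact: inj_comp ej.1.
    move=> V sV hV q; have [y <-] := qpi_surj q => Vy.
    apply/qpi_eq0.
    apply: (maxW (@qpi _ _ (Smod sW) @^-1` V)).
    - exact: submod_preimage.
    - move=> z Wz; rewrite /preimage /=.
      have -> : qpi (Smod sW) z = 0 by apply/qpi_eq0.
      exact: submod0.
    - move=> z Vix [z0 [x ex]]; apply: z0; rewrite -ex in Vix *.
      have sV' := submod_preimage p sV.
      have x0 : x = 0.
        apply: (ej.2 _ sV' _ x Vix) => t Vpjt.
        by apply: pinj; rewrite linear0; apply: hV.
      by rewrite x0 linear0.
    - exact: Vy.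
  have ps := maxE _ p (fin_gen_quo _ gY) pinj ep.
  have [g [pg gp]] := inv_bij pinj ps.
  by exists (g \o @qpi _ _ (Smod sW)) => x; apply: pg.
move=> X Y i h gX gY ii.
pose d : {linear X -> (E * Y)%type} := pairmap h (\- i).
pose V := Smod (submod_image d (submodT X)).
pose e : {linear E -> quo V} := @qpi _ _ V \o pinl E Y.
have einj : injective e.
  apply: lin_inj => x /qpi_eq0[z _ [<- e2]].
  (* The pushout E -> (E + Y) / X is injective because X -> Y is. *)
  have -> : z = 0 by apply: ii; rewrite linear0; apply/eqP; rewrite -oppr_eq0; apply/eqP.
  exact: linear0.
have [r hr] := split_mono _ e (fin_gen_quo _ (fin_gen_prod gE gY)) einj.
exists (r \o @qpi _ _ V \o pinr E Y) => x.
rewrite -[RHS]hr; congr (r _); apply/qpi_eq.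
exists (- x) => //; rewrite linearN; congr pair; rewrite /= ?sub0r ?subr0 //.
by rewrite opprK.
Qed.

End Hull.

(** * Cosyzygies of filtered modules *)

Section Complement.
Context (A : pzRingType).
Implicit Types S T M N U W E L P : lmodType A.

Fact addmap_linear M N (P : lmodType A) (f : {linear M -> P}) (g : {linear N -> P}) :
  linear (fun x : (M * N)%type => f x.1 + g x.2).
Proof. by move=> a u v; rewrite /= !linearP scalerDr addrACA. Qed.
Definition addmap M N (P : lmodType A) f g : {linear (M * N)%type -> P} := mklin (@addmap_linear M N P f g).

Lemma retract_complement U N (i : {linear U -> N}) (p : {linear N -> U}) :
  cancel i p -> let V := sub (Smod (submod_ker p)) in
  exists theta : {linear (U * V)%type -> N},
    injective theta /\ forall y, exists x, theta x = y.
Proof.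
move=> ip V; exists (addmap i (@subval _ _ _)); split.
  apply: lin_inj => -[u v] /= e.
  have pv : p (subval v) = 0 := sub_in v.
  have u0 : u = 0 by have := congr1 p e; rewrite linearD ip pv addr0 linear0.
  rewrite u0 linear0 add0r in e; rewrite u0; congr pair.
  exact: subval_inj.
move=> y; have h : sset (Smod (submod_ker p)) (y - i (p y)).
  by rewrite /= linearB ip subrr.
by exists (p y, mksub h) => /=; rewrite addrC subrK.
Qed.

(** The complement V turns summands of powers into honest powers, to which the
    exact sequence 0 -> T -> E -> E / T -> 0 applies componentwise. *)
Lemma addm_complement T U : addm T U -> exists k (V : lmodType A)
    (theta : {linear (U * V)%type -> {ffun 'I_k -> T}}),
  [/\ addm T V, injective theta & forall y, exists x, theta x = y].
Proof.
move=> /addm_power[k [i [p ip]]]; have [theta [ti ts]] := retract_complement ip.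
exists k, _, theta; split=> //.
have [g [tg gt]] := inv_bij ti ts.
apply: (addm_trans (addm_ffun k T)).
by apply: (@addm_retract _ _ _ (theta \o pinr U _) (snd \o g)) => v /=; rewrite tg.
Qed.

Definition ffmap k M N (f : {linear M -> N}) :
  {linear {ffun 'I_k -> M} -> {ffun 'I_k -> N}} := fftuple (fun i => f \o ffeval M i).

Lemma ffmapE k M N (f : {linear M -> N}) (x : {ffun 'I_k -> M}) i : ffmap k f x i = f (x i).
Proof. by rewrite ffunE. Qed.

Lemma short_exact_ffmap k M' M M'' (f : {linear M' -> M}) (g : {linear M -> M''}) :
  short_exact f g -> short_exact (ffmap k f) (ffmap k g).
Proof.
move=> [fi gs e]; split.
- by move=> x y /ffunP h; apply/ffunP => i; apply: fi; have := h i; rewrite !ffmapE.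
- move=> z; have /choice[y hy] : forall i, exists y, g y = z i by move=> i.
  by exists (finfun y); apply/ffunP => i; rewrite ffmapE ffunE.
- move=> y; split=> [/ffunP h|[x <-]].
    have /choice[x hx] : forall i, exists x, f x = y i.
      by move=> i; apply/e; rewrite -ffmapE h ffunE.
    by exists (finfun x); apply/ffunP => i; rewrite ffmapE ffunE.
  by apply/ffunP => i; rewrite !ffmapE ffunE; apply/e; exists (x i).
Qed.

Lemma short_exact_iso (L : lmodType A) M' M M'' (th : {linear L -> M'}) (f : {linear M' -> M}) (g : {linear M -> M''}) :
  injective th -> (forall y, exists x, th x = y) -> short_exact f g -> short_exact (f \o th) g.
Proof.
move=> ti ts [fi gs e]; split=> //; first exact: inj_comp.
move=> y; rewrite e; split=> [[x <-]|[x <-]]; last by exists (th x).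
by have [z <-] := ts x; exists z.
Qed.

Lemma relinj_ffun k E : relinj E -> relinj {ffun 'I_k -> E}.
Proof.
move=> hE X Y i h gX gY ii.
have /choice[h' hh'] : forall c : 'I_k, exists h' : {linear Y -> E}, forall x, h' (i x) = h x c.
  by move=> c; apply: (hE _ _ i (ffeval E c \o h)).
by exists (fftuple h') => x; apply/ffunP => c; rewrite ffunE.
Qed.

Lemma relinj_prod E E' : relinj E -> relinj E' -> relinj (E * E')%type.
Proof.
move=> hE hE' X Y i h gX gY ii.
have [a ha] := hE _ _ i (fst \o h) gX gY ii.
have [b hb] := hE' _ _ i (snd \o h) gX gY ii.
by exists (pairmap a b) => x /=; rewrite ha hb /=; case: (h x).
Qed.

Lemma fin_gen_ffun k M : fin_gen M -> fin_gen {ffun 'I_k -> M}.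
Proof. by move=> gM; apply: (addm_fin_gen gM); apply: addm_ffun. Qed.
End Complement.

Section Cosyzygy.
Context (A : pzRingType) (T E : lmodType A) (j : {linear T -> E}).
Hypotheses (gT : fin_gen T) (gE : fin_gen E) (ji : injective j) (hE : relinj E).
Let C := quo (Smod (submod_image j (submodT T))).

Lemma coker_exact : short_exact j (@qpi _ _ (Smod (submod_image j (submodT T)))).
Proof.
split=> //; first exact: qpi_surj.
by move=> y; rewrite qpi_eq0; split=> [[x _ <-]|[x <-]]; exists x.
Qed.

(** Horseshoe lemma: the embeddings of a piece and of the rest of N are combined
    into one embedding of N by extending the first to N, which is possible by
    injectivity; the cokernel is then an extension of the two cokernels.  The
    summand V collects what completes the pieces to powers of T. *)
Lemma cosyzygy n (N : lmodType A) : fin_gen N -> mfilt T n N ->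
  exists (V I Q : lmodType A) (phi : {linear (N * V)%type -> I}) (psi : {linear I -> Q}),
    [/\ addm T V, fin_gen I, relinj I, mfilt C n Q & short_exact phi psi].
Proof.
elim: n N => [|n IH] N gN /=.
  move=> /addm_complement[k [V [th [aV ti ts]]]].
  exists V, {ffun 'I_k -> E}, {ffun 'I_k -> C}, (ffmap k j \o th), (ffmap k (@qpi _ _ _)).
  split=> //; [exact: fin_gen_ffun|exact: relinj_ffun|exact: addm_ffun|].
  exact/short_exact_iso/short_exact_ffmap/coker_exact.
move=> [U [W [f [g [aU hW [fi gs fg]]]]]].
have [V [I [Q [phi [psi [aV gI hI hQ [phii psis pp]]]]]]] := IH W (fin_gen_surj gs gN) hW.
have [k [U' [th [aU' ti ts]]]] := addm_complement aU.
have [jki qks jk] := short_exact_ffmap k coker_exact.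
pose jk' := ffmap k j \o th.
pose a : {linear (U * U')%type -> (N * (U' * V))%type} := prodmap f (pinl U' V).
have ai : injective a by move=> [u u'] [v v'] [/fi -> ->].
have gV := addm_fin_gen gT aV; have gU' := addm_fin_gen gT aU'.
have gU := addm_fin_gen gT aU.
have [h hh] := relinj_ffun hE jk' (fin_gen_prod gU gU') (fin_gen_prod gN (fin_gen_prod gU' gV)) ai.
(* The second component vanishes exactly on the piece U + U'. *)
pose phi1 : {linear (N * (U' * V))%type -> I} := phi \o prodmap g (snd : {linear (U' * V)%type -> V}).
pose phi' := pairmap h phi1.
have phi1_0 x : phi1 x = 0 -> exists u, a u = x.
  case: x => x [u' v] /= e.
  have [gx ->] : (g x, v) = (0, 0) by apply: phii; rewrite e linear0.
  by have [u <-] := (fg x).1 gx; exists (u, u').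
have phi'0 x : phi' x = 0 -> x = 0.
  move=> e0; have e1 : h x = 0 := congr1 fst e0.
  have [u eu] := phi1_0 _ (congr1 snd e0 : phi1 x = 0).
  rewrite -eu; have -> : u = 0.
    by apply: ti; apply: jki; rewrite -[LHS]hh eu e1 !linear0.
  exact: linear0.
pose D := Smod (submod_image phi' (submodT _)).
have [|c hc] := factor_surj (p := ffmap k (@qpi _ _ _)) (g := @qpi _ _ D \o pinl _ I) qks.
  move=> x /jk[y <-]; apply/qpi_eq0; have [u <-] := ts y.
  exists (a u) => //; congr pair; first exact: hh.
  by rewrite /phi1; case: (u) => u1 u2 /=; rewrite (fg _).2 ?linear0 //; exists u1.
have [||d hd] := factor_surj (p := @qpi _ _ D) (g := psi \o snd).
- exact: qpi_surj.
- by move=> x /qpi_eq0[y _ <-] /=; apply/pp; eexists.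
exists (U' * V)%type, ({ffun 'I_k -> E} * I)%type, (quo D), phi', (@qpi _ _ D); split.
- exact: addm_prod.
- by apply: fin_gen_prod => //; apply: fin_gen_ffun.
- by apply: relinj_prod => //; apply: relinj_ffun.
- exists {ffun 'I_k -> C}, Q, c, d; split=> //; first exact: addm_ffun.
  split.
  + apply: lin_inj => q; have [x <-] := qks q; rewrite hc => /qpi_eq0[y _ [e1 e2]].
    have [u eu] := phi1_0 _ e2; apply/jk; exists (th u).
    by rewrite -e1 -eu hh.
  + by move=> z; have [y <-] := psis z; exists (qpi D (0, y)); rewrite hd.
  + move=> q; have [[x y] <-] := qpi_surj q; rewrite hd /=; split.
      move=> /pp[[w v] ew]; have [m em] := gs w.
      exists (ffmap k (@qpi _ _ _) (x - h (m, (0, v)))); rewrite hc /=.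
      apply/qpi_eq; exists (- (m, (0, v))) => //; rewrite linearN; congr pair => /=.
        by rewrite addrC addKr.
      by rewrite em ew sub0r.
    move=> [z]; have [x' <-] := qks z; rewrite hc /= => /(congr1 d).
    by rewrite !hd /= linear0.
- split; [exact: lin_inj|exact: qpi_surj|].
  by move=> y; rewrite qpi_eq0; split=> [[x _ <-]|[x <-]]; exists x.
Qed.
End Cosyzygy.

(** * The extension dimension *)

Section ModCat.
Context (A : pzRingType).

Lemma mod_isomorphic (M N : fgmod A) (f : {linear M -> N}) :
  injective f -> (forall y, exists x, f x = y) -> @isomorphic (mod_cat A) M N.
Proof. by move=> fi fs; have [g [fg gf]] := inv_bij fi fs; exists f, g; split. Qed.

Lemma dsum_fin_retract (M : lmodType A) k (Y : 'I_k -> mod_cat A)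
    (a : forall i, {linear M -> fgmod_mod (Y i)}) (b : forall i, {linear fgmod_mod (Y i) -> M}) :
  exists (i : {linear M -> fgmod_mod (dsum_fin Y)}) (p : {linear fgmod_mod (dsum_fin Y) -> M}),
    forall x, p (i x) = \sum_j b j (a j x).
Proof.
elim: k Y a b => [|k IH] Y a b.
  by exists \0, \0 => x; rewrite big_ord0.
have [i [p ip]] := IH _ (fun j => a (lift ord0 j)) (fun j => b (lift ord0 j)).
exists (pairmap (a ord0) i), (addmap (b ord0) p) => x /=.
by rewrite big_ord_recl ip.
Qed.

Lemma add_of_summand (U : subcat (mod_cat A)) (M M' X : fgmod A)
    (f : {linear dsum_fgmod M M' -> X}) : U X ->
  injective f -> (forall y, exists x, f x = y) -> Defs.add U M.
Proof.
move=> UX fi fs; exists M', 1%N, (fun=> X); split=> //=.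
apply: (@mod_isomorphic (dsum_fgmod M M') (dsum_fgmod X (zero_fgmod A)) (pinl _ _ \o f)).
  by move=> x y [/fi].
move=> [y z]; have [x ex] := fs y; exists x; rewrite /= ex; congr pair.
by apply/rowP; case.
Qed.

Lemma add_self (U : subcat (mod_cat A)) (M : fgmod A) : U M -> Defs.add U M.
Proof.
move=> UM; apply: (@add_of_summand U M (zero_fgmod A) M fst UM).
  by move=> [x y] [x' y'] /= ->; congr pair; apply/rowP; case.
by move=> y; exists (y, 0).
Qed.

Lemma addm_add (T M : fgmod A) : left_artinian A -> addm T M -> Defs.add (single (T : mod_cat A)) M.
Proof.
move=> aA [k [a [b h]]].
have [i [p ip]] := @dsum_fin_retract M k (fun=> T) a b.
have ipK : cancel i p by move=> x; rewrite ip -h.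
have [th [ti ts]] := retract_complement ipK.
have gV := fin_gen_sub (Smod (submod_ker p)) aA (fgmodP (dsum_fin (fun=> T : mod_cat A))).
exists (FgMod gV), k, (fun=> T); split=> //.
exact: (@mod_isomorphic (dsum_fgmod M (FgMod gV)) (dsum_fin (fun=> T : mod_cat A)) th).
Qed.

Lemma mfilt_ext_gen (T : fgmod A) n (M : lmodType A) (gM : fin_gen M) : left_artinian A ->
  mfilt T n M -> ext_gen (single (T : mod_cat A)) n.+1 (FgMod gM).
Proof.
move=> aA; elim: n M gM => [|n IH] M gM; first exact: (@addm_add T (FgMod gM)).
move=> [U [W [f [g [aU hW fg]]]]]; have [_ gs _] := fg.
have gU := addm_fin_gen (fgmodP T) aU; have gW := fin_gen_surj gs gM.
apply: add_self; exists (FgMod gU), (FgMod gW), f, g; split=> //.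
  exact: (@addm_add T (FgMod gU)).
exact: IH.
Qed.

Lemma addm_row n : addm (A^o) 'rV[A]_n.
Proof.
have hl (i : 'I_n) : linear (fun x : 'rV[A]_n => x 0 i : A^o).
  by move=> a u v; rewrite !mxE.
have hr (i : 'I_n) : linear (fun a : A^o => (a : A) *: delta_mx 0 i : 'rV[A]_n).
  by move=> a u v; rewrite scalerDl scalerA.
exists n, (fun i => mklin (hl i)), (fun i => mklin (hr i)) => x.
exact: row_sum_delta.
Qed.

Lemma row_cover (M : lmodType A) : fin_gen M ->
  exists n (p : {linear 'rV[A]_n -> M}), forall y, exists x, p x = y.
Proof.
move=> [n [e he]].
have hl : linear (fun x : 'rV[A]_n => \sum_i x 0 i *: e i).
  move=> a u v; rewrite scaler_sumr -big_split; apply: eq_bigr => i _.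
  by rewrite !mxE scalerDl scalerA.
exists n, (mklin hl) => y; have [c ->] := he y; exists (\row_i c i) => /=.
by apply: eq_bigr => i _; rewrite mxE.
Qed.

End ModCat.

(** With N the kernel of a free cover p : P -> M and N + V -> I as in [cosyzygy],
    extend the latter to h : P + V -> I.  Then (p, h) embeds P + V into M + I with
    cokernel Q, so M is a summand of an extension of Q by P + V. *)
Lemma ext_gen_of_lrep_chain (R : comNzRingType) (A : algType R) s : artin_algebra A -> lrep_chain A s ->
  exists T : mod_cat A, forall M : mod_cat A, ext_gen (single T) s.+2 M.
Proof.
move=> hA hs; have aA := artin_algebra_left_artinian hA.
have [T [gT hT]] := torsionless_mfilt hA hs.
have [E [j [gE ji hE]]] := relinj_hull hA gT.
pose C : lmodType A := quo (Smod (submod_image j (submodT T))).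
pose S : lmodType A := ((A^o * T) * C)%type.
have gC : fin_gen C by apply: fin_gen_quo.
have gS : fin_gen S.
  by apply: fin_gen_prod => //; apply: fin_gen_prod => //; apply: fin_gen_regular.
have aSA : addm S (A^o) := addm_trans (addm_pairl _ _) (addm_pairl _ _).
have aST : addm S T := addm_trans (addm_pairl _ _) (addm_pairr _ _).
exists (FgMod gS) => -[M gM].
have [n [p ps]] := row_cover gM.
have gP : fin_gen 'rV[A]_n := addm_fin_gen (fin_gen_regular A) (addm_row A n).
pose K := Smod (submod_ker p); pose N : lmodType A := sub K.
have gN : fin_gen N by apply: fin_gen_sub.
have hN : mfilt T s N.
  by apply: hT => //; exists n, (@subval _ _ _); apply: subval_inj.
have [V [I [Q [phi [psi [aV gI hI hQ [phii psis pp]]]]]]] := cosyzygy gT gE ji hE gN hN.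
have gV := addm_fin_gen gT aV.
pose i : {linear (N * V)%type -> ('rV[A]_n * V)%type} := prodmap (@subval _ _ _) idfun.
have ii : injective i by move=> [x v] [y w] [/subval_inj -> ->].
have [h hh] := hI _ _ i phi (fin_gen_prod gN gV) (fin_gen_prod gP gV) ii.
pose f : {linear ('rV[A]_n * V)%type -> (M * I)%type} := pairmap (p \o fst) h.
pose q : {linear ('rV[A]_n * I)%type -> (M * I)%type} := prodmap p idfun.
(* The cokernel of (p, h) is read off on P + I, which covers M + I. *)
pose d : {linear ('rV[A]_n * I)%type -> Q} := psi \o addmap (\- (h \o pinl _ V)) idfun.
have hker x v : p x = 0 -> exists y, phi y = h (x, v).
  by move=> px; exists (mksub (U := K) px, v); rewrite -hh.
have [||g hg] := factor_surj (p := q) (g := d).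
- by move=> [m y]; have [x ex] := ps m; exists (x, y); rewrite /= ex.
- move=> [x y] [px y0]; apply/pp; have [z hz] := hker x 0 px.
  exists (- z); rewrite linearN hz /=; have -> : y = 0 := y0.
  by rewrite addr0.
have fg : short_exact f g.
  split.
  - apply: lin_inj => -[x v] [px hxv]; have px0 : p x = 0 := px.
    have hxv0 : h (x, v) = 0 := hxv.
    have : phi (mksub (U := K) px0, v) = 0 by rewrite -hh.
    by move=> e; have [-> ->] : (mksub (U := K) px0, v) = 0 by apply: phii; rewrite e linear0.
  - move=> z; have [y <-] := psis z; exists (q (0, y)); rewrite hg /=.
    by rewrite (linear0 h) oppr0 add0r.
  - move=> [m y]; have [x ex] := ps m.
    have -> : (m, y) = q (x, y) by rewrite /= ex.
    rewrite hg; split=> [/pp[[w v] ew]|[[x' v] [e1 e2]]].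
      exists (x + subval w, v); congr pair; rewrite /= ?linearD.
        by rewrite [p (subval w)](sub_in w) addr0.
      have -> : (x + subval w, v) = (x, 0) + i (w, v) by congr pair; rewrite /= ?add0r.
      by rewrite linearD hh ew; apply: addNKr.
    have px : p (x' - x) = 0 by rewrite linearB; apply/eqP; rewrite subr_eq0; apply/eqP.
    apply/pp; have [z hz] := hker _ v px; exists z; rewrite hz /=.
    have -> : y = h (x', v) := esym e2.
    have -> : (x' - x, v) = (x', v) - (x, 0) by congr pair; rewrite /= ?subr0.
    by rewrite linearB addrC.
have gQ := fin_gen_surj psis gI.
have gMI := fin_gen_prod gM gI.
have gPV := fin_gen_prod gP gV.
apply: (@add_of_summand _ _ (FgMod gM) (FgMod gI) (FgMod gMI) idfun) => //; last first.
  by move=> y; exists y.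
exists (FgMod gPV), (FgMod gQ), f, g; split=> //.
  apply: (@addm_add _ (FgMod gS) (FgMod gPV)) => //; apply: addm_prod.
    exact: addm_trans aSA (addm_row A n).
  exact: addm_trans aST aV.
apply: (@mfilt_ext_gen _ (FgMod gS)) => //.
exact: mfilt_mono (addm_pairr _ _) hQ.
Qed.

(** * Filtrations of complexes *)

Section Complexes.
Context (A : pzRingType).
Implicit Types (X Y Z W : bcplx A) (T : lmodType A).

Definition zero_d X := forall i j (e : i + 1 = j) (x : X i), cd X e x = 0.

Definition short_exact_cplx X Y Z (f : chmap X Y) (g : chmap Y Z) := forall i, short_exact (f i) (g i).

(** A filtration with n + 1 pieces, each of which is, up to quasi-isomorphism, a
    complex with zero differential and components in add T.  Here the pieces are
    quotients, as in the definition of [gen]. *)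
Inductive cfilt T : nat -> bcplx A -> Prop :=
| cfilt_base X : (forall i, addm T (X i)) -> zero_d X -> cfilt T 0 X
| cfilt_ext n X Y Z (f : chmap X Y) (g : chmap Y Z) :
    cfilt T n X -> cfilt T 0 Z -> short_exact_cplx f g -> cfilt T n.+1 Y
| cfilt_qis n X Y (f : chmap X Y) : quasi_iso f -> cfilt T n X -> cfilt T n Y.

Lemma cfilt_mono (S T : lmodType A) n X : addm S T -> cfilt T n X -> cfilt S n X.
Proof.
move=> hST; elim=> {n X} [X hX dX|n X Y Z f g _ IHX _ IHZ fg|n X Y f qf _ IH].
- by apply: cfilt_base => // i; apply: addm_trans (hX i).
- exact: cfilt_ext fg.
- exact: cfilt_qis qf IH.
Qed.

Section Graded.
Context (V : int -> lmodType A) (gV : forall i, fin_gen (V i)).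
Hypothesis bV : exists N : nat, forall i : int, (N < `|i|)%N -> forall x : V i, x = 0.

Definition graded_cplx : bcplx A :=
  @BCplx A V (fun i j e => \0) (fun i j k e e' x => erefl) gV bV.

End Graded.

Lemma cocycle_submod X i : submod (@cocycle A X i).
Proof.
split=> [j e|x y hx hy j e|a x hx j e]; rewrite ?linear0 //.
  by rewrite linearD hx hy addr0.
by rewrite linearZ hx; apply: scaler0.
Qed.

Lemma coboundaryE X i (x : X i) :
  coboundary x <-> exists y, x = cd X (subrK 1 i) y.
Proof.
split=> [[j [e [y ->]]]|[y ->]]; last by exists (i - 1), (subrK 1 i), y.
have ej : j = i - 1 by rewrite -e addrK.
move: e y; rewrite ej => e y; exists y; by rewrite (Prop_irrelevance e (subrK 1 i)).
Qed.

Lemma coboundary_submod X i : submod (@coboundary A X i).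
Proof.
split; first by apply/coboundaryE; exists 0; rewrite linear0.
- move=> x y /coboundaryE[u ->] /coboundaryE[v ->]; apply/coboundaryE.
  by exists (u + v); rewrite linearD.
- move=> a x /coboundaryE[u ->]; apply/coboundaryE.
  by exists (a *: u); rewrite linearZ.
Qed.

Lemma coboundary_cocycle X i (x : X i) : coboundary x -> cocycle x.
Proof. by move=> [j [e [y ->]]] k e'; rewrite cdd. Qed.

Lemma bounded_of_inj X (V : int -> lmodType A) (f : forall i, {linear V i -> X i}) :
  (forall i, injective (f i)) ->
  exists N : nat, forall i : int, (N < `|i|)%N -> forall x : V i, x = 0.
Proof.
move=> fi; have [N hN] := cbounded X; exists N => i hi x.
by apply: (fi i); rewrite linear0; apply: hN.
Qed.

Section QuotCplx.
Context (X : bcplx A) (U : forall i, smod (X i)).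
Hypothesis dU : forall i j (e : i + 1 = j) x, sset (U i) x -> sset (U j) (cd X e x).

Definition quot_cplx_d i j (e : i + 1 = j) : {linear quo (U i) -> quo (U j)} :=
  sval (factor_surj (p := @qpi _ _ (U i)) (g := @qpi _ _ (U j) \o cd X e)
    (@qpi_surj _ _ (U i))
    (fun x h => (qpi_eq0 (U j) _).2 (dU e ((qpi_eq0 (U i) x).1 h)))).

Lemma quot_cplx_dE i j (e : i + 1 = j) x : quot_cplx_d e (qpi (U i) x) = qpi (U j) (cd X e x).
Proof. by rewrite /quot_cplx_d; case: factor_surj => h hh; apply: hh. Qed.

Fact quot_cplx_dd (i j k : int) (e : i + 1 = j) (e' : j + 1 = k) x :
  quot_cplx_d e' (quot_cplx_d e x) = 0.
Proof. by have [y <-] := qpi_surj x; rewrite !quot_cplx_dE cdd linear0. Qed.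

Fact quot_cplx_bounded : exists N : nat,
  forall i : int, (N < `|i|)%N -> forall x : quo (U i), x = 0.
Proof.
have [N hN] := cbounded X; exists N => i hi x.
by have [y <-] := qpi_surj x; rewrite (hN i hi y) linear0.
Qed.

Definition quot_cplx : bcplx A :=
  @BCplx A (fun i => quo (U i)) quot_cplx_d quot_cplx_dd
    (fun i => fin_gen_quo _ (cfg X i)) quot_cplx_bounded.

Definition quot_cplx_pi : chmap X quot_cplx :=
  @ChMap A X quot_cplx (fun i => @qpi _ _ (U i)) (fun i j e x => esym (quot_cplx_dE e x)).
End QuotCplx.

(** Over a semisimple ring a complex is quasi-isomorphic to its cohomology: a
    complement of the boundaries in the cycles is a graded submodule on which
    the differential vanishes, and its inclusion is a quasi-isomorphism. *)
Lemma cfilt_semisimple W : left_artinian A ->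
  (forall i a (x : W i), @jacobson_radical A a -> a *: x = 0) ->
  cfilt (quo (jacS A)) 0 W.
Proof.
move=> aA JW.
have hex i : exists H : set (W i), [/\ submod H, H `<=` @cocycle A W i,
    H `&` @coboundary A W i `<=` [set 0] & @cocycle A W i `<=` addset H (@coboundary A W i)].
  have [|||H [sH _ HZ HB ZH]] := radical_complement aA (submod_zero (W i))
    (@coboundary_submod W i) (@cocycle_submod W i).
  - by move=> _ ->; apply: submod0; apply: cocycle_submod.
  - by move=> x; apply: coboundary_cocycle.
  - by move=> a x Ja _; apply: JW.
  - by exists H.
pose H i := sval (cid (hex i)).
have hH i := svalP (cid (hex i)).
pose V i := Smod (let: And4 s _ _ _ := hH i in s).
have gV i : fin_gen (sub (V i)) by apply: fin_gen_sub => //; apply: cfg.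
have bV := @bounded_of_inj W (fun i => sub (V i)) (fun i => @subval _ _ _)
  (fun i => @subval_inj _ _ _).
have cm (i j : int) (e : i + 1 = j) (x : sub (V i)) :
    subval (0 : sub (V j)) = cd W e (subval x).
  by have [_ HZ _ _] := hH i; rewrite (HZ _ (sub_in x)).
pose f : chmap (graded_cplx gV bV) W := @ChMap _ (graded_cplx gV bV) W (fun i => @subval _ _ (V i)) cm.
apply: (@cfilt_qis _ _ (graded_cplx gV bV) W f); last first.
  apply: cfilt_base => // i; apply: addm_semisimple => //; first exact: gV.
  move=> a x Ja.
  by apply: subval_inj; rewrite linearZ linear0; apply: JW.
move=> i; have [_ HZ HB ZH] := hH i; split.
  move=> x _ hx; have -> : x = 0.
    by apply: subval_inj; apply: HB; split; [exact: (sub_in x)|].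
  exact: (submod0 (@coboundary_submod (graded_cplx gV bV) i)).
move=> y /ZH[h [b [Hh hb ->]]].
exists (mksub (U := V i) Hh); split; first by move=> j e.
by rewrite /= addrC addKr.
Qed.

End Complexes.

Section RestrictCplx.
Context (A B : pzRingType) (phi : {rmorphism A -> B}) (gB : fin_gen (resm phi (B^o))).

Definition resc (X : bcplx B) : bcplx A :=
  @BCplx A (fun i => resm phi (X i)) (fun i j e => reslin phi (cd X e)) (@cdd B X)
    (fun i => fin_gen_resm gB (cfg X i)) (cbounded X).

Definition resch (X Y : bcplx B) (f : chmap X Y) : chmap (resc X) (resc Y) :=
  @ChMap A (resc X) (resc Y) (fun i => reslin phi (f i)) (@chcomm B X Y f).

Lemma cfilt_resc T n X : cfilt T n X -> cfilt (resm phi T) n (resc X).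
Proof.
elim=> {n X} [X hX dX|n X Y Z f g _ IHX _ IHZ fg|n X Y f qf _ IH].
- by apply: cfilt_base => // i; apply: addm_resm.
- exact: (@cfilt_ext _ _ _ _ _ _ (resch f) (resch g)).
- exact: (@cfilt_qis _ _ _ _ _ (resch f)).
Qed.
End RestrictCplx.

(** As for modules, with the functoriality [radstep_fun] providing the
    differential of J X as a complex over B.  At the end of the chain the cycles
    of X and the quotient of X by them both have zero differential. *)
Lemma torsionless_cfilt (R : comNzRingType) (A : algType R) s : artin_algebra A -> lrep_chain A s ->
  exists T : lmodType A, fin_gen T /\
    forall X : bcplx A, (forall i, torsionless (X i)) -> cfilt T s.+1 X.
Proof.
move=> + hc; elim: hc => {A s} [A rA /artin_algebra_left_artinian aA|].
  have [T [gT hT]] := rep_finite_addm aA rA.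
  exists T; split=> // X _.
  pose U i := Smod (@cocycle_submod A X i).
  have gU i : fin_gen (sub (U i)) by apply: fin_gen_sub => //; apply: cfg.
  have bU := @bounded_of_inj A X (fun i => sub (U i)) (fun i => @subval _ _ _)
    (fun i => @subval_inj _ _ _).
  have cm (i j : int) (e : i + 1 = j) (x : sub (U i)) :
      subval (0 : sub (U j)) = cd X e (subval x) by rewrite (sub_in x).
  have dU i j (e : i + 1 = j) x : sset (U i) x -> sset (U j) (cd X e x).
    by move=> _ k e'; rewrite cdd.
  apply: (@cfilt_ext _ _ _ (graded_cplx gU bU) X (quot_cplx dU)
    (@ChMap _ (graded_cplx gU bU) X (fun i => @subval _ _ (U i)) cm) (quot_cplx_pi dU)).
  - by apply: cfilt_base => // i; apply: hT; apply: gU.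
  - apply: cfilt_base => [i|i j e x]; first by apply: hT; apply: fin_gen_quo; apply: cfg.
    have [y <-] := qpi_surj x; rewrite /= quot_cplx_dE; apply/qpi_eq0 => k e'.
    by rewrite cdd.
  - by move=> i; apply: sub_quo_exact.
move=> A B f s hB fi _ fJ _ IH hA; have [T [gT hT]] := IH hB.
have aA := artin_algebra_left_artinian hA.
pose phi : {rmorphism A -> B} := f.
have gB : fin_gen (resm phi (B^o)) by apply: artin_fin_gen_resm.
exists (resm phi T * quo (jacS A))%type; split.
  apply: fin_gen_prod; first exact: fin_gen_resm.
  exact/fin_gen_quo/fin_gen_regular.
move=> X tX.
have hS i : exists _ : radstep phi (X i), True.
  by have [S] := radstep_exists (phi := phi) fi (jac_image_absorbs fJ) (tX i); exists S.
pose S i := sval (cid (hS i)).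
pose d i j (e : i + 1 = j) := sval (radstep_fun (phi := phi) (jac_image_absorbs fJ) (cd X e) (S i) (S j)).
have dE i j (e : i + 1 = j) y : rs_map (S j) (d i j e y) = cd X e (rs_map (S i) y).
  by rewrite /d; case: radstep_fun => h hh; apply: hh.
have dd i j k (e : i + 1 = j) (e' : j + 1 = k) y : d j k e' (d i j e y) = 0.
  by apply: (@rs_inj _ _ _ _ (S k)); rewrite !dE cdd linear0.
have gY i : fin_gen (rs_mod (S i)).
  apply: (@fin_gen_of_resm _ _ phi).
  exact: (fin_gen_inj (@rs_inj _ _ _ _ (S i)) aA (cfg X i)).
have bY := @bounded_of_inj A X (fun i => resm phi (rs_mod (S i)))
  (fun i => rs_map (S i)) (fun i => @rs_inj _ _ _ _ (S i)).
pose Y : bcplx B := @BCplx B (fun i => rs_mod (S i)) d dd gY bY.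
pose K : chmap (resc gB Y) X := @ChMap A (resc gB Y) X (fun i => rs_map (S i)) dE.
have dJ i j (e : i + 1 = j) x : sset (jacmul (X i)) x -> sset (jacmul (X j)) (cd X e x).
  move: x; apply: lmulset_sub; first exact/submod_preimage/smodP.
  by move=> a x Ja _; rewrite /preimage /= linearZ; apply: lmulset_in.
apply: (@cfilt_ext _ _ _ (resc gB Y) X (quot_cplx dJ) K (quot_cplx_pi dJ)).
- apply: cfilt_mono (addm_pairl _ _) _; apply: cfilt_resc.
  by apply: hT => i; apply: rs_torsionless.
- apply: cfilt_mono (addm_pairr _ _) _; apply: cfilt_semisimple => //.
  move=> i a q Ja; have [x <-] := qpi_surj q; rewrite -linearZ; apply/qpi_eq0.
  exact: lmulset_in.
- move=> i; split; [exact: rs_inj|exact: qpi_surj|].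
  by move=> y; rewrite [quot_cplx_pi dJ i y]/(qpi _ y) qpi_eq0; apply: rs_img.
Qed.

(** * Replacing a complex by one with torsionless components *)

(** The size 0 for the zero module keeps the covers of a bounded complex bounded. *)
Lemma row_cover0 (A : pzRingType) (M : lmodType A) : fin_gen M ->
  exists n (p : {linear 'rV[A]_n -> M}),
    (forall y, exists x, p x = y) /\ ((forall x : M, x = 0) -> n = 0%N).
Proof.
move=> gM; have [M0|M0] := pselect (forall x : M, x = 0).
  by exists 0%N, \0; split=> // y; exists 0; rewrite [RHS]M0.
by have [n [p hp]] := row_cover gM; exists n, p.
Qed.

Section TorsionlessCover.
Context (A : pzRingType) (aA : left_artinian A) (X : bcplx A).

Definition cov_ex i := cid (row_cover0 (cfg X i)).
Definition cov_n i : nat := sval (cov_ex i).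
Local Notation n := cov_n.
Definition cov_map_ex i := cid (svalP (cov_ex i)).
Definition cov_map i : {linear 'rV[A]_(n i) -> X i} := sval (cov_map_ex i).
Local Notation p := cov_map.
Definition cov_map_surj i : forall y, exists x, p i x = y := (svalP (cov_map_ex i)).1.
Definition cov_n0 i : (forall x : X i, x = 0) -> n i = 0%N := (svalP (cov_map_ex i)).2.

Definition cov_P i : lmodType A := ('rV[A]_(n (i + 1)) * 'rV[A]_(n i))%type.
Local Notation P := cov_P.
Definition cov_w i : {linear P i -> X (i + 1)} :=
  addmap (p (i + 1)) (\- (cd X (erefl (i + 1)) \o p i)).
(** With free covers p i : F_i -> X_i, the component in degree i is the pullback
    of p (i + 1) and d p i, a submodule of F_(i+1) + F_i. *)
Definition cov_U i : smod (P i) := Smod (submod_ker (cov_w i)).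
Local Notation U := cov_U.
Fact cov_UE i (u : P i) : sset (U i) u <-> p (i + 1) u.1 = cd X (erefl (i + 1)) (p i u.2).
Proof.
split=> h; first by apply/eqP; rewrite -subr_eq0; apply/eqP.
by rewrite /= h subrr.
Qed.

(** The match on e avoids a transport along i + 1 = j. *)
Definition cov_dP i j (e : i + 1 = j) : {linear P i -> P j} :=
  match e with erefl => pinr _ _ \o fst end.

Fact cov_dPU i j (e : i + 1 = j) (x : sub (U i)) : exists y : sub (U j), subval y = cov_dP e (subval x).
Proof.
case: _ / e; have h : sset (U (i + 1)) (cov_dP erefl (subval x)).
  apply/cov_UE; rewrite /= linear0; have /cov_UE -> := sub_in x.
  by rewrite cdd.
by exists (mksub h).
Qed.

Definition cov_d i j (e : i + 1 = j) : {linear sub (U i) -> sub (U j)} :=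
  sval (factor_inj (g := cov_dP e \o @subval _ _ (U i)) (@subval_inj _ _ (U j)) (cov_dPU e)).
Fact cov_dE i j (e : i + 1 = j) x : subval (cov_d e x) = cov_dP e (subval x).
Proof. by rewrite /cov_d; case: factor_inj => h hh; apply: hh. Qed.

Fact cov_dd i j k (e : i + 1 = j) (e' : j + 1 = k) x : cov_d e' (cov_d e x) = 0.
Proof.
apply: subval_inj; rewrite !cov_dE; case: _ / e'; case: _ / e.
by congr pair.
Qed.

Fact row_size0 m (x : 'rV[A]_m) : m = 0%N -> x = 0.
Proof. by case: m x => // x _; apply: thinmx0. Qed.

Fact cov_bounded : exists N : nat, forall i : int, (N < `|i|)%N -> forall x : sub (U i), x = 0.
Proof.
have [M hM] := shift_bounded 1 X; have [N hN] := cbounded X.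
exists (maxn M N) => i; rewrite gtn_max => /andP[hi hi'] x.
apply: subval_inj; case: (subval x) => a b; congr pair; apply: row_size0; apply: cov_n0.
  exact: hM.
exact: hN.
Qed.

Fact cov_fg i : fin_gen (sub (U i)).
Proof.
have gr m : fin_gen 'rV[A]_m := addm_fin_gen (fin_gen_regular A) (addm_row A m).
by apply: fin_gen_sub => //; apply: fin_gen_prod; apply: gr.
Qed.

Definition cov_cplx : bcplx A := @BCplx A (fun i => sub (U i)) cov_d cov_dd cov_fg cov_bounded.
Local Notation N := cov_cplx.
Definition cov_q i : {linear N i -> X i} := p i \o snd \o @subval _ _ (U i).
Local Notation q := cov_q.
Fact cov_comm i j (e : i + 1 = j) (x : N i) : q j (cd N e x) = cd X e (q i x).
Proof.
rewrite /cov_q /= cov_dE; case: _ / e => /=.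
by have /cov_UE := sub_in x.
Qed.

(** The map (a, b) -> p b is surjective in each degree, and its kernel is the
    graded module with components ker p (i + 1) + ker p i and differential
    (a, b) -> (0, a), which is exact. *)
Lemma torsionless_cover : exists (N : bcplx A) (f : chmap N X),
  quasi_iso f /\ forall i, torsionless (N i).
Proof.
exists N, (ChMap cov_comm); split=> i; last first.
  have hl : linear (fun u : P i => row_mx u.1 u.2).
    by move=> a u v; rewrite /= -add_row_mx -scale_row_mx.
  exists (n (i + 1) + n i)%N, (mklin hl \o @subval _ _ (U i)).
  apply: inj_comp; last exact: subval_inj.
  by move=> [a b] [a' b'] /= /eq_row_mx[-> ->].
split.
  move=> x cx [j [e [y ey]]]; move: x cx ey; case: _ / e => x cx ey.
  have x1 : (subval x).1 = 0.
    have /(congr1 (@subval _ _ _)) := cx _ erefl; rewrite [LHS]cov_dE.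
    exact: (congr1 snd).
  have [c ec] := cov_map_surj y.
  have h : sset (U j) ((subval x).2, c) by apply/cov_UE; rewrite /= ec; exact: ey.
  exists j, erefl, (mksub h); apply: subval_inj; rewrite [RHS]cov_dE.
  have ex : subval x = (0, (subval x).2) by case: (subval x) x1 => a b /= ->.
  exact: ex.
move=> y cy; have [b eb] := cov_map_surj y.
have h : sset (U i) (0, b).
  by apply/cov_UE; rewrite /= linear0 eb; rewrite [RHS]cy.
exists (mksub h : N i); split.
  move=> j e; apply: subval_inj; rewrite /= cov_dE; case: _ / e => /=.
  by [].
rewrite /= eb subrr; exact: (submod0 (@coboundary_submod _ X i)).
Qed.
End TorsionlessCover.

(** * Isomorphisms and triangles in the derived category *)

Section DerivedIso.
Context (A : pzRingType).
Local Notation D := (Db_add A).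
Implicit Types X Y Z : bcplx A.

Lemma Dmap_eq X Y (f g : chmap X Y) : (forall i x, f i x = g i x) -> Deq (Dmap f) (Dmap g).
Proof.
move=> fg; apply: Deq_homotopic; exists (fun _ _ _ => \0) => i j k e e' x.
by rewrite fg subrr /= linear0 addr0.
Qed.

Lemma Diso_sym (X Y : D) : isomorphic X Y -> isomorphic Y X.
Proof. by move=> [f [g [gf fg]]]; exists g, f. Qed.

Lemma Diso_trans (X Y Z : D) : isomorphic X Y -> isomorphic Y Z -> isomorphic X Z.
Proof.
move=> [f [g [gf fg]]] [f' [g' [gf' fg']]].
have mid (X1 X2 X3 : bcplx A) (u : Dhom X2 X1) (v : Dhom X1 X2) (u' : Dhom X3 X2) (v' : Dhom X2 X3) :
    Deq (Dcomp u v) (Dmap (ch_id X1)) -> Deq (Dcomp u' v') (Dmap (ch_id X2)) ->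
    Deq (Dcomp (Dcomp u u') (Dcomp v' v)) (Dmap (ch_id X1)).
  move=> h h'; apply: Deq_trans h.
  apply: Deq_trans (Deq_sym (Deq_assoc _ _ _)) _.
  apply: Deq_comp (Deq_refl _) _.
  apply: Deq_trans (Deq_assoc _ _ _) _.
  by apply: Deq_trans (Deq_comp h' (Deq_refl _)) (Deq_idl _).
by exists (Dcomp f' f), (Dcomp g g'); split; apply: mid.
Qed.

Lemma Diso_qis X Y (f : chmap X Y) : quasi_iso f -> @isomorphic D X Y.
Proof.
move=> qf; exists (Dmap f), (Dinv qf); split; [exact: Deq_invl|exact: Deq_invr].
Qed.

Lemma qis_bij X Y (f : chmap X Y) : (forall i, injective (f i)) ->
  (forall i y, exists x, f i x = y) -> quasi_iso f.
Proof.
move=> fi fs i; split.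
  move=> x _ [j [e [y ey]]]; exists j, e; have [z ez] := fs j y.
  by exists z; apply: fi; rewrite ey -ez chcomm.
move=> y cy; have [x ex] := fs i y; exists x; split.
  by move=> j e; apply: fi; rewrite chcomm ex cy linear0.
rewrite ex subrr; exact: (submod0 (@coboundary_submod _ Y i)).
Qed.

Definition dsum_chmap X X' Y Y' (f : chmap X Y) (g : chmap X' Y') :
    chmap (dsum_cplx X X') (dsum_cplx Y Y') :=
  @ChMap A (dsum_cplx X X') (dsum_cplx Y Y') (fun i => prodmap (f i) (g i))
    (fun i j e x => congr2 pair (chcomm f e x.1) (chcomm g e x.2)).

Lemma qis_dsum X X' Y Y' (f : chmap X Y) (g : chmap X' Y') :
  quasi_iso f -> quasi_iso g -> quasi_iso (dsum_chmap f g).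
Proof.
have cobP (Z Z' : bcplx A) i (z : Z i) (z' : Z' i) :
    @coboundary A (dsum_cplx Z Z') i (z, z') <-> coboundary z /\ coboundary z'.
  split=> [[j [e [[u v] [-> ->]]]]|[/coboundaryE[u ->] /coboundaryE[v ->]]].
    by split; exists j, e; [exists u|exists v].
  by exists (i - 1), (subrK 1 i), (u, v).
have cocP (Z Z' : bcplx A) i (z : Z i) (z' : Z' i) :
    @cocycle A (dsum_cplx Z Z') i (z, z') <-> cocycle z /\ cocycle z'.
  split=> [h|[h h'] j e]; last by congr pair; [apply: h|apply: h'].
  by split=> j e; have [] := h j e.
move=> qf qg i; have [fi fs] := qf i; have [gi gs] := qg i; split.
  by move=> [x y] /cocP[cx cy] /cobP[hx hy]; apply/cobP; split; [apply: fi|apply: gi].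
move=> [x y] /cocP[/fs[x' [cx' hx]] /gs[y' [cy' hy]]].
by exists (x', y'); split; [apply/cocP|apply/(cobP _ _ _ (x - f i x') (y - g i y'))].
Qed.

Lemma qis_id X : quasi_iso (ch_id X).
Proof. by apply: qis_bij => [i x y|i y] //; exists y. Qed.

Lemma add_qis (U : subcat D) X Y (f : chmap X Y) : quasi_iso f ->
  Defs.add U (X : D) -> Defs.add U (Y : D).
Proof.
move=> qf [X' [n [Z [UZ iso]]]]; exists X', n, Z; split=> //.
apply: Diso_trans iso; apply: Diso_sym.
exact: (@Diso_qis _ _ (dsum_chmap f (ch_id X')) (qis_dsum qf (@qis_id X'))).
Qed.

(** Components in provably equal degrees are distinct types; this is the
    identity between them. *)
Definition transport (V : int -> lmodType A) i j (e : i = j) : {linear V i -> V j} :=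
  match e with erefl => idfun end.

Lemma transport_id (V : int -> lmodType A) i (e : i = i) x : transport V e x = x.
Proof. by rewrite (Prop_irrelevance e erefl). Qed.

Lemma transportK (V : int -> lmodType A) i j (e : i = j) (e' : j = i) x : transport V e' (transport V e x) = x.
Proof. by case: _ / e e' => e'; rewrite transport_id. Qed.

Lemma transport_cd X i i' j j' (ei : i = i') (ej : j = j') (e : i + 1 = j) (e' : i' + 1 = j') x :
  transport X ej (cd X e x) = cd X e' (transport X ei x).
Proof. by case: _ / ei e'; case: _ / ej => e'; rewrite (Prop_irrelevance e' e). Qed.

Fact shift0_comm X i j (e : i + 1 = j) (x : X i) :
  transport X (esym (addr0 j)) (cd X e x) = cd (shift_cplx 0 X) e (transport X (esym (addr0 i)) x).
Proof. by rewrite /= /shift_d_fun expr0 scale1r; apply: transport_cd. Qed.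

Definition shift0_map X : chmap X (shift_cplx 0 X) :=
  @ChMap A X (shift_cplx 0 X) (fun i => transport X (esym (addr0 i))) (@shift0_comm X).

Lemma qis_shift0 X : quasi_iso (shift0_map X).
Proof.
apply: qis_bij => i; first by apply: (can_inj (g := transport X (addr0 i))) => x;
    exact: (@transportK X _ _ (esym (addr0 i)) (addr0 i) x).
by move=> y; exists (transport X (addr0 i) y); exact: (@transportK X _ _ (addr0 i) (esym (addr0 i)) y).
Qed.

(** The definition of [gen1] uses shifts, so an object is first replaced by its
    isomorphic shift by 0. *)
Lemma gen1_self (I : subcat (Db A)) X : I X -> gen1 I X.
Proof.
move=> IX; exists (zero_cplx A), 1%N, (fun=> shift_cplx 0 X); split.
  by move=> _; exists X, 0.
exact: (@Diso_qis _ _ (dsum_chmap (shift0_map X) (ch_id _)) (qis_dsum (@qis_shift0 X) (@qis_id _))).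
Qed.

Section Triangle.
Context (X Y Z : bcplx A) (f : chmap X Y) (g : chmap Y Z) (fg : short_exact_cplx f g).

Fact cone_quot_comm i j (e : i + 1 = j) (p : cone f i) :
  (g j \o snd) (cd (cone f) e p) = cd Z e ((g i \o snd) p).
Proof.
case: _ / e; case: p => x y; rewrite /= linearD chcomm.
by have [_ _ h] := fg (i + 1); rewrite (h _).2 ?add0r //; exists x.
Qed.
Definition cone_quot : chmap (cone f) Z :=
  @ChMap A (cone f) Z (fun i => g i \o snd) cone_quot_comm.

(** For a short exact sequence 0 -> X -> Y -> Z -> 0 the cone of X -> Y is a
    resolution of Z. *)
Lemma cone_quot_qis : quasi_iso cone_quot.
Proof.
move=> i; split.
  move=> [x y] cxy [j [e [z ez]]]; move: x y cxy ez; case: _ / e => x y cxy ez.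
  have [e1 e2] := cxy _ erefl.
  have [_ gs _] := fg j; have [y1 ey1] := gs z.
  have [fi _ h] := fg (j + 1); have [fi' _ _] := fg (j + 1 + 1).
  have [x1 ex1] : exists x1, f (j + 1) x1 = y - cd Y erefl y1.
    by apply/h; rewrite linearB chcomm ey1 -ez subrr.
  exists j, erefl, (x1, y1); congr pair => /=; last by rewrite ex1 subrK.
  apply: fi'; rewrite linearN chcomm ex1 linearB cdd subr0.
  by apply/eqP; rewrite -addr_eq0; apply/eqP.
move=> z cz; have [_ gs _] := fg i; have [y ey] := gs z.
have [_ _ h] := fg (i + 1); have [fi' _ _] := fg (i + 1 + 1).
have [x ex] : exists x, f (i + 1) x = cd Y erefl y.
  by apply/h; rewrite chcomm ey cz.
exists (- x, y); split; last first.
  by rewrite /= ey subrr; exact: (submod0 (@coboundary_submod _ Z i)).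
move=> j e; case: _ / e; congr pair => /=; last by rewrite linearN ex addNr.
by rewrite linearN opprK; apply: fi'; rewrite chcomm ex cdd linear0.
Qed.

(** The triangle is the standard one of f, with the cone replaced by Z. *)
Lemma star_ses (I1 I2 : subcat (Db A)) : I1 X -> I2 Z -> star I1 I2 Y.
Proof.
move=> h1 h2; exists X, Z, (Dmap f), (Dmap g),
  (Dcomp (Dmap (cone_out f)) (Dinv cone_quot_qis)); split=> //.
exists X, Y, f, (Dmap (ch_id X)), (Dmap (ch_id Y)), (Dmap cone_quot); split.
  have idiso W : is_iso (Dmap (ch_id W) : @mor D W W).
    by exists (Dmap (ch_id W)); split; apply: Deq_idl.
  split=> //; exists (Dinv cone_quot_qis).
  by split; [apply: Deq_invl|apply: Deq_invr].
split.
- exact: Deq_trans (Deq_idl _) (Deq_sym (Deq_idr _)).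
- apply: Deq_trans (Deq_map_comp _ _) _.
  apply: Deq_trans (Deq_sym (Deq_idr _)).
  by apply: Dmap_eq.
- apply: Deq_trans (Deq_map_comp _ _) _.
  apply: Deq_sym; apply: Deq_trans (Deq_sym (Deq_assoc _ _ _)) _.
  apply: Deq_trans (Deq_comp (Deq_refl _) (Deq_invl _)) _.
  apply: Deq_trans (Deq_idr _) _.
  by apply: Dmap_eq.
Qed.
End Triangle.
End DerivedIso.

(** * From filtrations of complexes to generation *)

Section DerivedAdd.
Context (A : pzRingType) (aA : left_artinian A).
Local Notation D := (Db_add A).
Implicit Types X Y Z : bcplx A.

Section Kernel.
Context (Z X : bcplx A) (p : chmap Z X).
Definition ker_cplx_U i : smod (Z i) := Smod (submod_ker (p i)).

Fact ker_cplx_closed i j (e : i + 1 = j) (x : sub (ker_cplx_U i)) :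
  exists y : sub (ker_cplx_U j), subval y = cd Z e (subval x).
Proof.
have h : sset (ker_cplx_U j) (cd Z e (subval x)).
  by have px : p i (subval x) = 0 := sub_in x; rewrite /= chcomm px linear0.
by exists (mksub h).
Qed.

Definition ker_cplx_d i j (e : i + 1 = j) : {linear sub (ker_cplx_U i) -> sub (ker_cplx_U j)} :=
  sval (factor_inj (g := cd Z e \o @subval _ _ (ker_cplx_U i)) (@subval_inj _ _ _) (ker_cplx_closed e)).
Fact ker_cplx_dE i j (e : i + 1 = j) x : subval (ker_cplx_d e x) = cd Z e (subval x).
Proof. by rewrite /ker_cplx_d; case: factor_inj => h hh; apply: hh. Qed.
Fact ker_cplx_dd i j k (e : i + 1 = j) (e' : j + 1 = k) x : ker_cplx_d e' (ker_cplx_d e x) = 0.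
Proof. by apply: subval_inj; rewrite !ker_cplx_dE cdd. Qed.

Definition ker_cplx : bcplx A := @BCplx A (fun i => sub (ker_cplx_U i)) ker_cplx_d ker_cplx_dd
  (fun i => fin_gen_sub _ aA (cfg Z i))
  (@bounded_of_inj A Z (fun i => sub (ker_cplx_U i)) (fun i => @subval _ _ _)
    (fun i => @subval_inj _ _ _)).

(** Splitting off the kernel of the retraction gives the complement that [add]
    asks for, already at the level of complexes. *)
Lemma retract_dsum (i : chmap X Z) : (forall n x, p n (i n x) = x) ->
  @isomorphic D (dsum_cplx X ker_cplx) Z.
Proof.
move=> ip.
have cm n m (e : n + 1 = m) (x : dsum_cplx X ker_cplx n) :
    addmap (i m) (@subval _ _ (ker_cplx_U m)) (cd (dsum_cplx X ker_cplx) e x) =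
    cd Z e (addmap (i n) (@subval _ _ (ker_cplx_U n)) x).
  by rewrite /= ker_cplx_dE chcomm linearD.
apply: (@Diso_qis _ _ _ (@ChMap A (dsum_cplx X ker_cplx) Z _ cm)); apply: qis_bij => n.
  apply: lin_inj => -[x k] /= e.
  have pk : p n (subval k) = 0 := sub_in k.
  have x0 : x = 0 by have := congr1 (p n) e; rewrite linearD ip pk addr0 linear0.
  by rewrite x0 linear0 add0r in e; rewrite x0; congr pair; apply: subval_inj.
move=> y; have h : sset (ker_cplx_U n) (y - i n (p n y)) by rewrite /= linearB ip subrr.
by exists (p n y, mksub h); rewrite /= addrC subrK.
Qed.
End Kernel.

Lemma dsum_fin_chretract X k (Y : 'I_k -> D) (a : forall j, chmap X (Y j : bcplx A))
    (b : forall j, chmap (Y j : bcplx A) X) :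
  exists (i : chmap X (dsum_fin Y)) (p : chmap (dsum_fin Y) X),
    forall n x, p n (i n x) = \sum_j b j n (a j n x).
Proof.
elim: k Y a b => [|k IH] Y a b.
  have c1 i j (e : i + 1 = j) (x : X i) : (\0 : {linear X j -> zero_mod A}) (cd X e x) =
    cd (zero_cplx A) e ((\0 : {linear X i -> zero_mod A}) x) by [].
  have c2 i j (e : i + 1 = j) (x : zero_cplx A i) : (\0 : {linear zero_mod A -> X j}) (cd (zero_cplx A) e x) =
    cd X e ((\0 : {linear zero_mod A -> X i}) x) by rewrite /= linear0.
  exists (@ChMap A X (zero_cplx A) (fun=> \0) c1), (@ChMap A (zero_cplx A) X (fun=> \0) c2).
  by move=> n x; rewrite big_ord0.
have [i [p ip]] := IH _ (fun j => a (lift ord0 j)) (fun j => b (lift ord0 j)).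
pose Y0 : bcplx A := Y ord0; pose Y1 : bcplx A := dsum_fin (fun j => Y (lift ord0 j)).
have c1 n m (e : n + 1 = m) x : pairmap (a ord0 m) (i m) (cd X e x) =
    cd (dsum_cplx Y0 Y1) e (pairmap (a ord0 n) (i n) x).
  by congr pair; rewrite /= chcomm.
have c2 n m (e : n + 1 = m) x : addmap (b ord0 m) (p m) (cd (dsum_cplx Y0 Y1) e x) =
    cd X e (addmap (b ord0 n) (p n) x).
  by rewrite /= !chcomm linearD.
exists (@ChMap A X (dsum_cplx Y0 Y1) _ c1), (@ChMap A (dsum_cplx Y0 Y1) X _ c2) => n x /=.
by rewrite big_ord_recl ip.
Qed.

(** If the identity of X factors through a finite family of complexes, X is a
    retract of their direct sum. *)
Lemma add_of_factor (U : subcat D) X (I : finType) (Y : I -> bcplx A)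
    (a : forall j, chmap X (Y j)) (b : forall j, chmap (Y j) X) :
  (forall j, U (Y j)) -> (forall n x, \sum_j b j n (a j n x) = x) -> Defs.add U (X : D).
Proof.
move=> UY ab.
have [i [p ip]] := @dsum_fin_chretract X #|I| (fun j => Y (enum_val j))
  (fun j => a (enum_val j)) (fun j => b (enum_val j)).
exists (ker_cplx p), #|I|, (fun j => Y (enum_val j)); split=> //.
apply: (@retract_dsum _ _ p i) => n x; rewrite ip -[RHS]ab.
rewrite [RHS](reindex (@enum_val I I)) //; exact/onW_bij/enum_val_bij.
Qed.

Section Stalk.
Context (T : lmodType A) (gT : fin_gen T).

Definition stalk_mod (i : int) : lmodType A := if i is Posz 0 then T else zero_mod A.

Fact stalk_fg i : fin_gen (stalk_mod i).
Proof. by case: i => [[|i]|i] //; apply: fin_gen_zero. Qed.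
Fact stalk_bounded : exists N : nat, forall i : int, (N < `|i|)%N -> forall x : stalk_mod i, x = 0.
Proof. by exists 0%N; case=> [[|i]|i] // _ x; apply/rowP; case. Qed.
Definition stalk : bcplx A := graded_cplx stalk_fg stalk_bounded.

Context (X : bcplx A) (X0 : zero_d X).

Definition into_stalk d (al : {linear X d -> T}) l : {linear X l -> stalk_mod (l - d)} :=
  if pselect (l = d) is left e
  then transport stalk_mod (esym (etrans (congr1 (fun k => k - d) e) (subrr d))) \o
    ((al : {linear X d -> stalk_mod 0}) \o transport X e)
  else \0.

Definition from_stalk d (be : {linear T -> X d}) l : {linear stalk_mod (l - d) -> X l} :=
  if pselect (l = d) is left e
  then transport X (esym e) \o ((be : {linear stalk_mod 0 -> X d}) \o
    transport stalk_mod (etrans (congr1 (fun k => k - d) e) (subrr d)))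
  else \0.

Lemma from_into_stalk d al be l (x : X l) :
  from_stalk be l (into_stalk al l x) =
  if pselect (l = d) is left e then transport X (esym e) (be (al (transport X e x))) else 0.
Proof.
rewrite /from_stalk /into_stalk; case: pselect => [e|ne] //=.
by rewrite transportK.
Qed.

Fact into_stalk_comm d (al : {linear X d -> T}) i j (e : i + 1 = j) x :
  into_stalk al j (cd X e x) = cd (shift_cplx (- d) stalk) e (into_stalk al i x).
Proof. by rewrite X0 linear0 /= /shift_d_fun /= scaler0. Qed.

Fact from_stalk_comm d (be : {linear T -> X d}) i j (e : i + 1 = j)
    (x : shift_cplx (- d) stalk i) :
  from_stalk be j (cd (shift_cplx (- d) stalk) e x) = cd X e (from_stalk be i x).
Proof. by rewrite X0 /= /shift_d_fun /= scaler0 linear0. Qed.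

(** Only finitely many components are nonzero, and each is a summand of a power
    of T; so the identity of X factors through finitely many shifted copies of T,
    one for each degree and each index of the factorisation in that degree. *)
Lemma gen1_graded : (forall i, addm T (X i)) -> gen1 (single (stalk : Db A)) X.
Proof.
move=> hX; have [N hN] := cbounded X.
(* The degrees from - N to N. *)
pose deg (m : 'I_(N + N).+1) : int := m%:Z - N%:Z.
have hk m : exists k, exists al : 'I_k -> {linear X (deg m) -> T},
    exists be : 'I_k -> {linear T -> X (deg m)}, forall x, x = \sum_i be i (al i x) := hX (deg m).
pose k m := sval (cid (hk m)); have hk1 m := svalP (cid (hk m)).
pose al m := sval (cid (hk1 m)); have hk2 m := svalP (cid (hk1 m)).
pose be m := sval (cid (hk2 m)); have hk3 m := svalP (cid (hk2 m)).
pose I : finType := {m : 'I_(N + N).+1 & 'I_(k m)}.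
apply: (@add_of_factor _ X I (fun j => shift_cplx (- deg (tag j)) stalk)
  (fun j => @ChMap A X (shift_cplx (- deg (tag j)) stalk) (into_stalk (al _ (tagged j)))
     (into_stalk_comm (al _ (tagged j))))
  (fun j => @ChMap A (shift_cplx (- deg (tag j)) stalk) X (from_stalk (be _ (tagged j)))
     (from_stalk_comm (be _ (tagged j))))).
  by move=> j; exists stalk, (- deg (tag j)).
move=> l x /=.
rewrite -(@sig_big_dep _ _ _ _ (fun m => 'I_(k m)) xpredT (fun _ => xpredT)
  (fun m c => from_stalk (be m c) l (into_stalk (al m c) l x))) /=.
have [lN|lN] := leqP `|l|%N N; last first.
  rewrite (hN l lN x) big1 // => m _; rewrite big1 // => c _.
  by rewrite !linear0.
have [m0 em0] : exists m0, l = deg m0.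
  have h : (`|(l + N%:Z)%R| < (N + N).+1)%N by lia.
  by exists (Ordinal h); rewrite /deg /=; lia.
rewrite (bigD1 m0) //= [X in _ + X]big1 ?addr0; last first.
  move=> m mm0; rewrite big1 // => c _; rewrite from_into_stalk.
  case: pselect => // e; case/eqP: mm0; apply/val_inj.
  by move: e; rewrite em0 /deg => /addIr[].
case: _ / (esym em0) x => x.
rewrite [RHS]hk3; apply: eq_bigr => c _; rewrite from_into_stalk.
by case: pselect => // e; rewrite !transport_id.
Qed.
End Stalk.

Lemma cfilt_gen (T : lmodType A) (gT : fin_gen T) n X : cfilt T n X ->
  gen (single (stalk gT : Db A)) n.+1 X.
Proof.
elim=> {n X} [X hX X0|n X Y Z f g _ IHX _ IHZ fg|n X Y f qf _ IH].
- exact: gen1_graded.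
- by apply: gen1_self; apply: (star_ses fg).
- by case: n IH => [|n]; apply: add_qis qf.
Qed.
End DerivedAdd.

Lemma gen_of_lrep_chain (R : comNzRingType) (A : algType R) s : artin_algebra A -> lrep_chain A s ->
  exists X : Db A, forall Y : Db A, gen (single X) s.+2 Y.
Proof.
move=> hA hs; have aA := artin_algebra_left_artinian hA.
have [T [gT hT]] := torsionless_cfilt hA hs.
exists (stalk gT) => Y; apply: (cfilt_gen aA).
by have [N [f [qf tN]]] := torsionless_cover aA Y; apply: (cfilt_qis qf); apply: hT.
Qed.

(** * The two inequalities *)

Lemma nat_inf_le (P : set nat) n : P n -> (nat_inf P <= (n%:Z)%:E)%E.
Proof.
move=> Pn; rewrite /nat_inf; case: pselect => [exP|nP]; last first.
  by case: nP; exists n; apply/asboolP.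
by case: ex_minnP => m _ /(_ n (asboolT Pn)); rewrite lee_fin.
Qed.

Lemma lrep_disP (R : comNzRingType) (A : algType R) :
  lrep_dis A = +oo%E \/ exists2 s, lrep_chain A s & lrep_dis A = (s%:Z)%:E.
Proof.
rewrite /lrep_dis; case: asboolP => [rA|_].
  by right; exists 0%N => //; apply: lrep_chain0.
rewrite /nat_inf; case: pselect => [exP|_]; last by left.
by right; case: ex_minnP => s /asboolP cs _; exists s.
Qed.

Theorem corollary4p6 (R : comNzRingType) (A : algType R) (hA : artin_algebra A) :
  (tri_dim (Db A) <= 2%:E * lrep_dis A + 1)%E /\
  (ext_dim A <= lrep_dis A + 1)%E.
Proof.
have [->|[s cs ->]] := lrep_disP A.
  by split; rewrite ?gt0_muley ?lte_fin // addye // leey.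
split.
  apply: (@le_trans _ _ ((s.+1%:Z)%:E)).
    exact/nat_inf_le/gen_of_lrep_chain.
  rewrite -EFinM -EFinD lee_fin; lia.
apply: (@le_trans _ _ ((s.+1%:Z)%:E)).
  exact/nat_inf_le/ext_gen_of_lrep_chain.
by rewrite -EFinD lee_fin; lia.
Qed.
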